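(* Let $(\mathbf x,B)$ be a seed of $\mathcal F$, with $\mathbf x=(x_1,\dots,x_m)$. Then the group of units of the cluster algebra $\mathcal A(\mathbf x,B)$ is $$\mathcal A(\mathbf x,B)^\times=\{\lambda\, x_{n+1}^{a_{n+1}}\cdots x_p^{a_p}\mid \lambda\in K^\times,\ a_{n+1},\dots,a_p\in\mathbb Z\}.$$
   Context: Let $K$ be a field of characteristic $0$ or $K=\mathbb Z$. Fix integers $m\ge p\ge n\ge 1$ with $m>1$, and let $\mathcal F=K(X_1,\dots,X_m)$ be the field of rational functions in $m$ variables. For $B=(b_{ij})\in M_{m,n}(\mathbb Z)$ the principal part $B^\circ$ is the $n\times n$ matrix formed by the first $n$ rows. $B$ is connected if the graph with vertices $1,\dots,m$ and an edge between $i$ and $j$ whenever $b_{ij}\neq 0$ or $b_{ji}\ne 0$ is connected. A square integer matrix $A$ is skew-symmetrizable if $DA$ is skew-symmetric for some diagonal integer matrix $D$ with positive diagonal entries. A seed of $\mathcal F$ is a pair $(\mathbf x,B)$ where $B\in M_{m,n}(\mathbb Z)$ is connected with $B^\circ$ skew-symmetrizable, and $\mathbf x=(x_1,\dots,x_m)$ is an $m$-tuple of elements of $\mathcal F$ algebraically independent over $K$. For $1\le k\le n$ the mutation $\mu_k(\mathbf x,B)=(\mathbf x',B')$ is given by $b'_{ij}=-b_{ij}$ if $i=k$ or $j=k$, and $b'_{ij}=b_{ij}+\frac{|b_{ik}|b_{kj}+b_{ik}|b_{kj}|}{2}$ otherwise; $x'_s=x_s$ for $s\neq k$ and $x'_k=x_k^{-1}\big(\prod_{b_{ik}>0}x_i^{b_{ik}}+\prod_{b_{ik}<0}x_i^{-b_{ik}}\big)$.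 Two seeds are mutation equivalent if one is obtained from the other by a finite sequence of mutations $\mu_{i_1},\dots,\mu_{i_t}$ with $1\le i_j\le n$. The cluster algebra $\mathcal A(\mathbf x,B)$ is the $K$-subalgebra of $\mathcal F$ generated by $x_{n+1}^{\pm1},\dots,x_p^{\pm1},x_{p+1},\dots,x_m$ together with all elements $y_1,\dots,y_n$ for all seeds $(\mathbf y,C)$ mutation equivalent to $(\mathbf x,B)$; these $y_i$ are the cluster variables. *)

(* Defs.v *)
From HB Require Import structures.
From mathcomp Require Import all_boot all_order all_algebra.
From mathcomp Require Import fraction.
From mathcomp Require Import mpoly.
Set Implicit Arguments. Unset Strict Implicit. Unset Printing Implicit Defensive.
Import Order.TTheory GRing.Theory Num.Theory.
Local Open Scope ring_scope.

(* Ambient field F = K(X_1, ..., X_m): fraction field of K[X_1..X_m].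
   (For K = Z this is Frac(Z[X]) = Q(X), as in the paper.) *)
Definition ratfun (K : idomainType) (m : nat) := {fraction {mpoly K[m]}}.

Definition Kto (K : idomainType) (m : nat) (c : K) : ratfun K m :=
  tofrac (c%:MP : {mpoly K[m]}).

Definition alg_indep (K : idomainType) (m : nat) (x : 'I_m -> ratfun K m) :=
  forall P : {mpoly K[m]}, mmap (@Kto K m) x P = 0 -> P = 0.

(* Connectedness of B : graph on {1..m} (0-based here), edge i--j iff
   b_ij <> 0 or b_ji <> 0 (entries b_ij exist only for column j < n). *)
Definition badj (m n : nat) (B : 'M[int]_(m, n)) : rel 'I_m :=
  fun i j =>
    (if insub (val j) : option 'I_n is Some j' then B i j' != 0 else false)
 || (if insub (val i) : option 'I_n is Some i' then B j i' != 0 else false).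

Definition connected_mx (m n : nat) (B : 'M[int]_(m, n)) :=
  forall i j : 'I_m, connect (badj B) i j.

Definition principal (m n : nat) (nm : (n <= m)%N) (B : 'M[int]_(m, n)) : 'M[int]_n :=
  \matrix_(i < n, j < n) B (widen_ord nm i) j.

Definition skew_symmetrizable (n : nat) (A : 'M[int]_n) :=
  exists d : 'I_n -> int, (forall i, 0 < d i) /\
    forall i j, d i * A i j = - (d j * A j i).

Definition is_seed (K : idomainType) (m n : nat) (nm : (n <= m)%N)
    (x : 'I_m -> ratfun K m) (B : 'M[int]_(m, n)) :=
  [/\ alg_indep x, connected_mx B & skew_symmetrizable (principal nm B)].

Definition mut_B (m n : nat) (nm : (n <= m)%N) (B : 'M[int]_(m, n)) (k : 'I_n)
  : 'M[int]_(m, n) :=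
  let kr := widen_ord nm k in
  \matrix_(i < m, j < n)
    if (i == kr) || (j == k) then - B i j
    else B i j + ((`|B i k| * B kr j + B i k * `|B kr j|) %/ 2)%Z.

Definition mut_x (K : idomainType) (m n : nat) (nm : (n <= m)%N)
    (x : 'I_m -> ratfun K m) (B : 'M[int]_(m, n)) (k : 'I_n) : 'I_m -> ratfun K m :=
  fun s =>
    if s == widen_ord nm k then
      (x s)^-1 * (\prod_(i < m | 0 < B i k) x i ^ B i k
                  + \prod_(i < m | B i k < 0) x i ^ (- B i k))
    else x s.

Definition mutate (K : idomainType) (m n : nat) (nm : (n <= m)%N)
    (s : ('I_m -> ratfun K m) * 'M[int]_(m, n)) (k : 'I_n) :=
  (mut_x nm s.1 s.2 k, mut_B nm s.2 k).

Inductive mut_equiv (K : idomainType) (m n : nat) (nm : (n <= m)%N)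
    (s : ('I_m -> ratfun K m) * 'M[int]_(m, n))
  : ('I_m -> ratfun K m) * 'M[int]_(m, n) -> Prop :=
| me_refl : mut_equiv nm s s
| me_step t k : mut_equiv nm s t -> mut_equiv nm s (mutate nm t k).

Definition cluster_var (K : idomainType) (m n : nat) (nm : (n <= m)%N)
    (x : 'I_m -> ratfun K m) (B : 'M[int]_(m, n)) (y : ratfun K m) :=
  exists t (i : 'I_n), mut_equiv nm (x, B) t /\ y = t.1 (widen_ord nm i).

Inductive in_subalg (K : idomainType) (m : nat) (S : ratfun K m -> Prop)
  : ratfun K m -> Prop :=
| sa_const c : in_subalg S (Kto m c)
| sa_gen y : S y -> in_subalg S y
| sa_add y z : in_subalg S y -> in_subalg S z -> in_subalg S (y + z)
| sa_mul y z : in_subalg S y -> in_subalg S z -> in_subalg S (y * z).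

Definition cluster_gens (K : idomainType) (m n p : nat) (nm : (n <= m)%N)
    (x : 'I_m -> ratfun K m) (B : 'M[int]_(m, n)) (y : ratfun K m) :=
  [\/ cluster_var nm x B y,
      exists i : 'I_m, [/\ (n <= i)%N, (i < p)%N & (y = x i \/ y = (x i)^-1)]
    | exists i : 'I_m, (p <= i)%N /\ y = x i].

Definition cluster_alg (K : idomainType) (m n p : nat) (nm : (n <= m)%N)
    (x : 'I_m -> ratfun K m) (B : 'M[int]_(m, n)) : ratfun K m -> Prop :=
  in_subalg (cluster_gens p nm x B).

Definition unit_of (K : idomainType) (m : nat) (A : ratfun K m -> Prop) (u : ratfun K m) :=
  A u /\ exists v, A v /\ u * v = 1.

(* Main.v *)
(* Write [x' = mu_k x].  By the Laurent phenomenon the cluster algebra lies in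
   [K[x^{+-1}]] and in [K[x'^{+-1}]], whose units are the Laurent monomials times units
   of [K].  The exchange relation [x_k x_k' = M + N] has a right-hand side that divides
   no monomial, so a unit has exponent [0] at every mutable [k].  At a non-inverted
   frozen [i], specialise [x_i] to [0] and the other [x_l] to [1]: all mutable cluster
   variables become positive rationals, so the whole algebra is defined at this point,
   and a unit cannot contain [x_i].

   The Laurent phenomenon is proved by induction on the mutation sequence
   [k, j, ...]: by induction the final variable is Laurent in the clusters [mu_k x] and
   [mu_k mu_j mu_k x] (the latter leads to the same end in one step less), so it suffices
   that [x_k'] is prime and prime to the two new variables of the latter.
   After adjoining a frozen variable [z] with [b_zk = 1], the exchange binomial of [k] is
   linear in [z], hence prime, and reduction modulo it is a substitution for [z]; finally
   [z] is set to [1]. *)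
Require Import Defs.
From HB Require Import structures.
From Stdlib Require Import FunctionalExtensionality.
From mathcomp Require Import all_boot all_order all_algebra.
From mathcomp Require Import fraction.
From mathcomp Require Import mpoly.
From mathcomp Require Import ring lra zify.
Set Implicit Arguments. Unset Strict Implicit. Unset Printing Implicit Defensive.
Import Order.TTheory GRing.Theory Num.Theory.
Local Open Scope ring_scope.

(** * Partial specialisations *)

(** A relation rather than a map, because a specialisation is defined on a local subring only. A
    subring also takes this form, with an arbitrary second component, as in [laurent_ring]. *)
Record ring_rel (R S : pzRingType) (W : R -> S -> Prop) : Prop := RingRel {
  rrel0 : W 0 0;
  rrel1 : W 1 1;
  rrelD : forall a b c d, W a c -> W b d -> W (a + b) (c + d);
  rrelM : forall a b c d, W a c -> W b d -> W (a * b) (c * d) }.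

Section RingRel.
Variables (R S : pzRingType) (W : R -> S -> Prop) (rW : ring_rel W).

Lemma rrel_prod (I : Type) (r : seq I) (P : pred I) (F : I -> R) (G : I -> S) :
  (forall i, P i -> W (F i) (G i)) ->
  W (\prod_(i <- r | P i) F i) (\prod_(i <- r | P i) G i).
Proof.
move=> FG; apply: (big_ind2 W) => //; first exact: (rrel1 rW).
by move=> *; apply: (rrelM rW).
Qed.

Lemma rrel_sum (I : Type) (r : seq I) (P : pred I) (F : I -> R) (G : I -> S) :
  (forall i, P i -> W (F i) (G i)) ->
  W (\sum_(i <- r | P i) F i) (\sum_(i <- r | P i) G i).
Proof.
move=> FG; apply: (big_ind2 W) => //; first exact: (rrel0 rW).
by move=> *; apply: (rrelD rW).
Qed.

Lemma rrelX a c n : W a c -> W (a ^+ n) (c ^+ n).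
Proof.
by move=> ac; elim: n => [|n IH]; rewrite ?expr0 ?exprS; [apply: (rrel1 rW)|apply: (rrelM rW)].
Qed.

End RingRel.

Section Specialisation.
Variables (R : comNzRingType) (E0 E1 : fieldType).
Variables (f : {rmorphism R -> E0}) (g : {rmorphism R -> E1}).

(* The ring homomorphism induced by [g] from the local ring
   [{f P / f Q | g Q != 0}] to [E1], as a relation. *)
Definition spec (a : E0) (c : E1) :=
  exists P Q, [/\ g Q != 0, a = f P / f Q & c = g P / g Q].

Hypothesis ker_fg : forall P, f P = 0 -> g P = 0.

Let f_neq0 Q : g Q != 0 -> f Q != 0.
Proof. by apply: contra_neq => /ker_fg. Qed.

Lemma spec_base P : spec (f P) (g P).
Proof. by exists P, 1; rewrite !rmorph1 !divr1; split=> //; apply: oner_neq0. Qed.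

(** Two fractions for [a] cross-multiply to an element of the kernel of [f], which [g] kills by
    [ker_fg]. *)
Lemma spec_fun a c d : spec a c -> spec a d -> c = d.
Proof.
move=> [P [Q [nzQ -> ->]]] [P' [Q' [nzQ' /eqP]]].
rewrite eqr_div ?f_neq0 // -!rmorphM -subr_eq0 -rmorphB => /eqP /ker_fg.
move/eqP; rewrite rmorphB subr_eq0 !rmorphM => e ->.
by apply/eqP; rewrite eqr_div.
Qed.

Lemma spec_ring : ring_rel spec.
Proof.
split.
- by have := spec_base 0; rewrite !rmorph0.
- by have := spec_base 1; rewrite !rmorph1.
- move=> a b c d [P [Q [nzQ -> ->]]] [P' [Q' [nzQ' -> ->]]].
  exists (P * Q' + P' * Q), (Q * Q').
  rewrite !addf_div ?f_neq0 // !rmorphD !rmorphM /=.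
  by split=> //; rewrite mulf_neq0.
- move=> a b c d [P [Q [nzQ -> ->]]] [P' [Q' [nzQ' -> ->]]].
  exists (P * P'), (Q * Q').
  by rewrite !mulf_div !rmorphM; split=> //; rewrite mulf_neq0.
Qed.

Lemma specV a c : c != 0 -> spec a c -> spec a^-1 c^-1.
Proof.
move=> nzc [P [Q [nzQ -> ec]]]; exists Q, P; rewrite ec !invf_div; split=> //.
by apply: contraNneq nzc => gP; rewrite ec gP mul0r.
Qed.

Lemma spec_neq0 a c : spec a c -> c != 0 -> a != 0.
Proof.
move=> [P [Q [nzQ -> ->]]]; rewrite !mulf_eq0 !invr_eq0 !negb_or => /andP[nzP _].
by rewrite !f_neq0.
Qed.

End Specialisation.

(** * Mutations *)

(** The positive part [max(b, 0)] as a natural number, so that exchange monomials are products of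
    natural powers over all indices. *)
Definition pz (b : int) : nat := if b is Posz n then n else 0%N.

Lemma pzB b : (pz b)%:Z - (pz (- b))%:Z = b.
Proof. by case: b => [[|n]|n] //=; lia. Qed.

Lemma pz_gt0 b : 0 < b -> (pz b)%:Z = b /\ pz (- b) = 0%N.
Proof. by case: b => [[|n]|n]. Qed.

(* [(`|a| * b + a * `|b|) / 2], without the division. *)
Definition bmul (a b : int) : int :=
  if (0 < a) && (0 < b) then a * b
  else if (a < 0) && (b < 0) then - (a * b) else 0.

Lemma bmulNN a b : bmul (- a) (- b) = - bmul a b.
Proof. by rewrite /bmul; do !case: ifP => //; nia. Qed.

Lemma bmulE a b : ((`|a| * b + a * `|b|) %/ 2)%Z = bmul a b.
Proof.
suff -> : `|a| * b + a * `|b| = bmul a b * 2 by rewrite mulzK.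
by rewrite /bmul; do !case: ifP; case: (ltrgt0P a) => ? //; case: (ltrgt0P b) => ? //; nia.
Qed.

(** The sign hypotheses put both sides in corresponding cases of [bmul]; the products agree through
    [dk]: [di a b = - dk a' b = dj b' a']. *)
Lemma skew_bmul (a a' b b' di dj dk : int) :
  di * a = - (dk * a') -> dk * b = - (dj * b') ->
  (0 < a) = (a' < 0) -> (0 < a') = (a < 0) ->
  (0 < b) = (b' < 0) -> (0 < b') = (b < 0) ->
  di * bmul a b = - (dj * bmul b' a').
Proof.
move=> e1 e2 h1 h2 h3 h4; rewrite /bmul h2 h4 -h1 -h3.
rewrite [(b < 0) && _]andbC [(0 < b) && _]andbC.
have e : di * (a * b) = dj * (b' * a').
  transitivity (- (dk * a') * b); first by rewrite -e1; ring.
  transitivity (- (dk * b) * a'); [by ring | rewrite e2; ring].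
case: (ltrgt0P a) => _; case: (ltrgt0P b) => _ /=; rewrite ?mulr0 ?oppr0 ?mulrN ?opprK ?e //.
Qed.

Section Matrices.
Variable I : finType.
Implicit Types (B : I -> I -> int) (i j k : I).

Definition mutb B k i j : int :=
  if (i == k) || (j == k) then - B i j else B i j + bmul (B i k) (B k j).

Definition skewz B := exists2 d : I -> int,
  (forall i, 0 < d i) & forall i j, d i * B i j = - (d j * B j i).

(** The first mutation negates row and column [k], so by [bmulNN] the second correction cancels the
    first. *)
Lemma mutbK B k : mutb (mutb B k) k = B.
Proof.
apply: functional_extensionality => i; apply: functional_extensionality => j.
rewrite /mutb !eqxx !orbT /=; case: (eqVneq i k) => [->|ik]; first by rewrite opprK.
case: (eqVneq j k) => [->|jk] /=; first by rewrite opprK.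
by rewrite bmulNN addrK.
Qed.

Lemma skewz_diag B i : skewz B -> B i i = 0.
Proof. by case=> d d0 /(_ i i); have := d0 i; nia. Qed.

Lemma skewz_gt0 B i j : skewz B -> (0 < B i j) = (B j i < 0).
Proof. by case=> d d0 /(_ i j); have := d0 i; have := d0 j => ? ? ?; apply/idP/idP; nia. Qed.

Lemma skewzN B : skewz B -> skewz (fun i j => - B i j).
Proof. by case=> d d0 dB; exists d => // i j; rewrite !mulrN dB. Qed.

Lemma skewz_mutb B k : skewz B -> skewz (mutb B k).
Proof.
move=> sB; have [d d0 dB] := sB; exists d => // i j; rewrite /mutb orbC.
case: ifP => [_|_]; first by rewrite !mulrN dB.
rewrite !mulrDr dB opprD; congr (_ + _).
by apply: (@skew_bmul _ _ _ _ _ _ (d k)); rewrite -?dB ?skewz_gt0 // dB opprK.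
Qed.

End Matrices.

Section Seeds.
Variables (I : finType) (E : fieldType).
Implicit Types (x : I -> E) (B : I -> I -> int) (i j k : I) (w : seq I).
Implicit Types (s : (I -> E) * (I -> I -> int)).

Definition exch x B k :=
  \prod_i x i ^+ pz (B i k) + \prod_i x i ^+ pz (- B i k).

Definition mutx x B k i := if i == k then (x k)^-1 * exch x B k else x i.

Definition mut s k := (mutx s.1 s.2 k, mutb s.2 k).

Definition muts s w := foldl mut s w.

Fixpoint nonvanishing s w : Prop :=
  (forall i, s.1 i != 0) /\ (if w is k :: w' then nonvanishing (mut s k) w' else True).

(** Only the inverted variables must be nonzero, which admits points with a vanishing frozen
    coordinate. *)
Fixpoint mutable s w : Prop :=
  if w is k :: w' then s.1 k != 0 /\ mutable (mut s k) w' else True.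

Lemma nonvanishing_mutable s w : nonvanishing s w -> mutable s w.
Proof. by elim: w s => [|k w IH] s //= [nx /IH]; split. Qed.

Lemma nonvanishing0 s w i : nonvanishing s w -> s.1 i != 0.
Proof. by case: w => [|k w] []. Qed.

Lemma nonvanishing_muts s w i : nonvanishing s w -> (muts s w).1 i != 0.
Proof. by elim: w s => [|k w IH] s [] // _ /IH. Qed.

Lemma exchN x B k : exch x (fun i j => - B i j) k = exch x B k.
Proof. by rewrite /exch addrC; congr (_ + _); apply: eq_bigr => i _; rewrite opprK. Qed.

Lemma mutxN x B k : mutx x (fun i j => - B i j) k = mutx x B k.
Proof. by rewrite /mutx exchN. Qed.

Lemma mutbN B k : mutb (fun i j => - B i j) k = fun i j => - mutb B k i j.
Proof.
apply: functional_extensionality => i; apply: functional_extensionality => j.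
by rewrite /mutb bmulNN; case: ifP => // _; rewrite opprD.
Qed.

Lemma exch_mut x B k : B k k = 0 -> exch (mutx x B k) (mutb B k) k = exch x B k.
Proof.
move=> Bkk; rewrite -[RHS]exchN; congr (_ + _); apply: eq_bigr => i _;
  rewrite /mutx /mutb eqxx orbT; by case: eqVneq => [->|//]; rewrite Bkk oppr0.
Qed.

(** The exchange binomial does not contain [x_k], so it is the same in both mutations; it cancels,
    being nonzero because the mutated variable is. *)
Lemma mutK x B k : B k k = 0 -> x k != 0 -> mutx x B k k != 0 ->
  mut (mut (x, B) k) k = (x, B).
Proof.
move=> Bkk xk; rewrite {1}/mutx eqxx mulf_eq0 negb_or => /andP[_ nzP].
rewrite /mut /= mutbK; congr (_, _); apply: functional_extensionality => i.
rewrite {1}/mutx exch_mut //; case: (eqVneq i k) => [->|ik].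
  by rewrite /mutx eqxx invfM invrK -mulrA mulVf // mulr1.
by rewrite /mutx (negbTE ik).
Qed.

Lemma mutK_nonvanishing x B k w : B k k = 0 -> nonvanishing (x, B) (k :: w) ->
  mut (mut (x, B) k) k = (x, B).
Proof.
by move=> Bkk [/= nx /(nonvanishing0 k) /= nx']; apply: mutK.
Qed.

End Seeds.

Section MutationRelation.
Variables (I : finType) (E0 E1 : fieldType) (W : E0 -> E1 -> Prop).
Hypotheses (rW : ring_rel W) (WV : forall a c, c != 0 -> W a c -> W a^-1 c^-1).

Lemma exch_rel X x (B : I -> I -> int) k :
  (forall i, W (X i) (x i)) -> W (exch X B k) (exch x B k).
Proof.
by move=> Xx; apply: (rrelD rW); apply: rrel_prod => // i _; apply: rrelX.
Qed.

Lemma mutx_rel X x (B : I -> I -> int) k : (forall i, W (X i) (x i)) -> x k != 0 ->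
  forall i, W (mutx X B k i) (mutx x B k i).
Proof.
move=> Xx xk i; rewrite /mutx; case: ifP => // _.
by apply: (rrelM rW); [apply: WV|apply: exch_rel].
Qed.

(** A mutation uses ring operations and the inverse of one variable, hence commutes with a
    specialisation that keeps this variable nonzero. *)
Lemma muts_rel X x (B : I -> I -> int) w : (forall i, W (X i) (x i)) ->
  mutable (x, B) w ->
  forall i, W ((muts (X, B) w).1 i) ((muts (x, B) w).1 i).
Proof.
elim: w X x B => [|k w IH] X x B Xx //= [nx nw] i; apply: IH => //.
exact: mutx_rel.
Qed.

(** Nonvanishing lifts from a special point, so one convenient point suffices to prove it. *)
Lemma nonvanishing_rel X x (B : I -> I -> int) w :
  (forall a c, W a c -> c != 0 -> a != 0) -> (forall i, W (X i) (x i)) ->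
  nonvanishing (x, B) w -> nonvanishing (X, B) w.
Proof.
move=> W0; elim: w X x B => [|k w IH] X x B Xx [nx nw].
  by split=> // i; apply: W0 (Xx i) (nx i).
split=> [i|]; first exact: W0 (Xx i) (nx i).
by apply: IH nw; apply: mutx_rel.
Qed.

End MutationRelation.

(** * Positive rational points *)

Section Positivity.
Variables (E : fieldType) (char0 : forall n, (n%:R == 0 :> E) = (n == 0%N)).

Definition posrat (c : E) :=
  exists a b : nat, [/\ (0 < a)%N, (0 < b)%N & c = a%:R / b%:R].

Let nz n : (0 < n)%N -> n%:R != 0 :> E.
Proof. by rewrite char0 lt0n. Qed.

Lemma posrat_neq0 c : posrat c -> c != 0.
Proof. by move=> [a [b [a0 b0 ->]]]; rewrite mulf_neq0 ?invr_eq0 ?nz. Qed.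

Lemma posrat1 : posrat 1.
Proof. by exists 1%N, 1%N; rewrite divr1. Qed.

Lemma posratD c d : posrat c -> posrat d -> posrat (c + d).
Proof.
move=> [a [b [a0 b0 ->]]] [a' [b' [a0' b0' ->]]].
exists (a * b' + a' * b)%N, (b * b')%N; rewrite addf_div ?nz // natrD !natrM.
by split=> //; nia.
Qed.

Lemma posratM c d : posrat c -> posrat d -> posrat (c * d).
Proof.
move=> [a [b [a0 b0 ->]]] [a' [b' [a0' b0' ->]]].
exists (a * a')%N, (b * b')%N; rewrite mulf_div !natrM.
by split=> //; nia.
Qed.

Lemma posratV c : posrat c -> posrat c^-1.
Proof. by move=> [a [b [a0 b0 ->]]]; exists b, a; rewrite invf_div. Qed.

Lemma posratX c n : posrat c -> posrat (c ^+ n).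
Proof.
move=> pc; elim: n => [|n IH]; first by rewrite expr0; apply: posrat1.
by rewrite exprS; apply: posratM.
Qed.

Variable I : finType.
Implicit Types (x : I -> E) (B : I -> I -> int) (o : option I).

Definition posrat_but o x := forall i, if Some i == o then x i = 0 else posrat (x i).

(** A vanishing coordinate [z] divides at most one of the two exchange monomials, depending on the
    sign of [B z k]; the other one stays positive. *)
Lemma posrat_but_exch o x B k : posrat_but o x -> posrat (exch x B k).
Proof.
move=> px; pose M (e : I -> nat) := \prod_i x i ^+ e i.
have posM (e : I -> nat) : (forall i, Some i = o -> e i = 0%N) -> posrat (M e).
  move=> e0; apply: (big_ind posrat) => [||i _]; [exact: posrat1|exact: posratM|].
  have := px i; case: eqP => [/e0 -> _|_ pi]; last exact: posratX.
  by rewrite expr0; apply: posrat1.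
have M0 (e : I -> nat) i : Some i = o -> (0 < e i)%N -> M e = 0.
  move=> io ei; rewrite /M (bigD1 i) //=; have := px i; rewrite io eqxx => ->.
  by rewrite expr0n eqn0Ngt ei mul0r.
rewrite /exch -[X in X + _]/(M (fun i => pz (B i k))) -[X in _ + X]/(M (fun i => pz (- B i k))).
case: o px posM M0 => [z|] px posM M0; last by apply: posratD; apply: posM.
case: (ltrgt0P (B z k)) => Bz.
- rewrite (M0 _ z) ?add0r //; last by case: (B z k) Bz => // -[].
  by apply: posM => i [->]; case: (B z k) Bz => // -[].
- rewrite addrC (M0 _ z) ?add0r //; last by case: (B z k) Bz => // -[].
  by apply: posM => i [->]; case: (B z k) Bz => // -[].
- by apply: posratD; apply: posM => i [->]; rewrite Bz.
Qed.

Lemma posrat_but_mutx o x B k : Some k != o ->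
  posrat_but o x -> posrat_but o (mutx x B k).
Proof.
move=> ko px i; rewrite /mutx; case: (eqVneq i k) => [->|_]; last exact: px.
rewrite (negbTE ko); apply: posratM; last exact: posrat_but_exch px.
by apply: posratV; have := px k; rewrite (negbTE ko).
Qed.

Lemma posrat_nonvanishing x B w : posrat_but None x -> nonvanishing (x, B) w.
Proof.
elim: w x B => [|k w IH] x B px; split=> //; try by move=> i; apply: posrat_neq0 (px i).
by apply: IH; apply: posrat_but_mutx.
Qed.

Lemma posrat_but_mutable o x B w : (forall k, k \in w -> Some k != o) ->
  posrat_but o x -> mutable (x, B) w.
Proof.
elim: w x B => [|k w IH] x B //= wo px.
have ko : Some k != o by apply: wo; rewrite inE eqxx.
split; first by apply: posrat_neq0; have := px k; rewrite (negbTE ko).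
by apply: IH => [j jw|]; [apply: wo; rewrite inE jw orbT|apply: posrat_but_mutx].
Qed.

End Positivity.

(** * Generic points *)

(** Laurent polynomials over the integers as syntax: the same expression can be evaluated at points
    of every field. *)
Inductive lexpr (I : Type) :=
  | Cst of int | Var of I | Inv of I
  | Add of lexpr I & lexpr I | Mul of lexpr I & lexpr I.

Fixpoint evl (I : Type) (E : fieldType) (x : I -> E) (e : lexpr I) : E :=
  match e with
  | Cst c => c%:~R
  | Var i => x i
  | Inv i => (x i)^-1
  | Add e1 e2 => evl x e1 + evl x e2
  | Mul e1 e2 => evl x e1 * evl x e2
  end.

Definition laurent (I : Type) (E : fieldType) (x : I -> E) (a : E) :=
  exists e, a = evl x e.

Section Laurent.
Variables (I : finType) (E : fieldType) (x : I -> E).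

Lemma laurentC (c : int) : laurent x c%:~R.
Proof. by exists (Cst I c). Qed.

Lemma laurent_var i : laurent x (x i).
Proof. by exists (Var i). Qed.

Lemma laurent_inv i : laurent x (x i)^-1.
Proof. by exists (Inv i). Qed.

Lemma laurentD a b : laurent x a -> laurent x b -> laurent x (a + b).
Proof. by move=> [e ->] [e' ->]; exists (Add e e'). Qed.

Lemma laurentM a b : laurent x a -> laurent x b -> laurent x (a * b).
Proof. by move=> [e ->] [e' ->]; exists (Mul e e'). Qed.

Lemma laurentN a : laurent x a -> laurent x (- a).
Proof. by move=> La; rewrite -mulN1r; apply: laurentM => //; apply: (laurentC (-1)). Qed.

Lemma laurent_ring (S : pzRingType) : ring_rel (fun a (_ : S) => laurent x a).
Proof.
split; [exact: (laurentC 0)|exact: (laurentC 1)| |] => *.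
  exact: laurentD.
exact: laurentM.
Qed.

Lemma laurent_prod (J : Type) (r : seq J) (P : pred J) (F : J -> E) :
  (forall i, P i -> laurent x (F i)) -> laurent x (\prod_(i <- r | P i) F i).
Proof. exact: (@rrel_prod _ _ _ (laurent_ring int) _ _ _ _ (fun=> 0)). Qed.

Lemma laurentX a n : laurent x a -> laurent x (a ^+ n).
Proof. exact: (@rrelX _ _ _ (laurent_ring int) _ 0). Qed.

Lemma laurent_exch B k : laurent x (exch x B k).
Proof.
by apply: laurentD; apply: laurent_prod => i _; apply: laurentX; apply: laurent_var.
Qed.

Lemma laurent_mutx B k i : laurent x (mutx x B k i).
Proof.
rewrite /mutx; case: ifP => _; last exact: laurent_var.
by apply: laurentM; [apply: laurent_inv|apply: laurent_exch].
Qed.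

End Laurent.

Lemma evl_rel (I : Type) (E0 E1 : fieldType) (W : E0 -> E1 -> Prop)
    (X : I -> E0) (x : I -> E1) e : ring_rel W -> (forall n : int, W n%:~R n%:~R) ->
  (forall i, W (X i) (x i)) -> (forall i, W (X i)^-1 (x i)^-1) ->
  W (evl X e) (evl x e).
Proof.
by move=> rW Wn Wx WV; elim: e => //= e IH e' IH'; [apply: (rrelD rW)|apply: (rrelM rW)].
Qed.

(** Independent variables that specialise to every point of every field; results found here are
    carried to all other points. *)
Record generic_point (I : finType) := GenericPoint {
  gen_field : fieldType;
  gen_var : I -> gen_field;
  gen_spec : forall E : fieldType, (I -> E) -> gen_field -> E -> Prop;
  gen_spec_var : forall E x i, @gen_spec E x (gen_var i) (x i);
  gen_spec_int : forall E x (n : int), @gen_spec E x n%:~R n%:~R;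
  gen_spec_ring : forall E x, ring_rel (@gen_spec E x);
  gen_specV : forall E x a c, c != 0 -> @gen_spec E x a c -> @gen_spec E x a^-1 c^-1;
  gen_spec_fun : forall E x a c d, @gen_spec E x a c -> @gen_spec E x a d -> c = d;
  gen_spec_neq0 : forall E x a c, @gen_spec E x a c -> c != 0 -> a != 0 }.

(* Opaque, so that conversion never unfolds the fraction field. *)
Lemma generic_point_exists (I : finType) : generic_point I.
Proof.
(* Integer coefficients map to every field, whatever its characteristic. *)
pose R := {mpoly int[#|I|]}; pose K := {fraction R}.
pose f : {rmorphism R -> K} := @tofrac R.
pose g (E : fieldType) (x : I -> E) : {rmorphism R -> E} := mmap intr (x \o enum_val).
have ker E x P : f P = 0 -> @g E x P = 0.
  by move/eqP; rewrite tofrac_eq0 => /eqP ->; rewrite rmorph0.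
apply: (@GenericPoint I K (fun i => f 'X_(enum_rank i)) (fun E x => spec f (@g E x))).
- move=> E x i; have := spec_base f (@g E x) 'X_(enum_rank i).
  by rewrite /g /= mmapX mmap1U /= enum_rankK.
- by move=> E x n; have := spec_base f (@g E x) n%:~R; rewrite !rmorph_int.
- by move=> E x; apply: spec_ring; apply: ker.
- by move=> E x a c; apply: specV.
- by move=> E x a c d; apply: spec_fun; apply: ker.
- by move=> E x a c; apply: spec_neq0; apply: ker.
Qed.

Definition genK (I : finType) : fieldType := gen_field (generic_point_exists I).
Definition genX (I : finType) : I -> genK I := gen_var (generic_point_exists I).

Section GenericSpecialisation.
Variables (I : finType) (E : fieldType) (x : I -> E).

Definition gspec : genK I -> E -> Prop :=
  @gen_spec I (generic_point_exists I) E x.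

Lemma gspecX i : gspec (genX i) (x i). Proof. exact: gen_spec_var. Qed.

Lemma gspec_ring : ring_rel gspec. Proof. exact: gen_spec_ring. Qed.

Lemma gspecV a c : c != 0 -> gspec a c -> gspec a^-1 c^-1.
Proof. exact: gen_specV. Qed.

Lemma gspec_fun a c d : gspec a c -> gspec a d -> c = d.
Proof. exact: gen_spec_fun. Qed.

Lemma gspec_neq0 a c : gspec a c -> c != 0 -> a != 0.
Proof. exact: gen_spec_neq0. Qed.

Lemma gspecC (n : int) : gspec n%:~R n%:~R.
Proof. exact: gen_spec_int. Qed.

Lemma gspec_evl e : (forall i, x i != 0) -> gspec (evl (@genX I) e) (evl x e).
Proof.
move=> nx; apply: evl_rel => [|n|i|i]; [exact: gspec_ring|exact: gspecC|exact: gspecX|].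
by apply: gspecV (gspecX i).
Qed.

End GenericSpecialisation.

(** At the all-ones point over the rationals every cluster variable is positive. *)
Lemma nonvanishing_genX (I : finType) (B : I -> I -> int) w :
  nonvanishing (@genX I, B) w.
Proof.
pose x (i : I) : rat := 1.
apply: (@nonvanishing_rel _ _ _ (gspec x) _ _ _ x).
- exact: gspec_ring.
- exact: gspecV.
- exact: gspec_neq0.
- exact: gspecX.
- apply: posrat_nonvanishing; first by move=> n; rewrite pnatr_eq0.
  by move=> i; apply: posrat1.
Qed.

(** * Three mutations in two directions *)

Lemma bigD1_expr (I : finType) (E : fieldType) (x : I -> E) (e : I -> nat) j :
  \prod_i x i ^+ e i = x j ^+ e j * \prod_(i | i != j) x i ^+ e i.
Proof. by rewrite (bigD1 j). Qed.

Lemma exch_linear (I : finType) (E : fieldType) (x : I -> E) B (z k : I) :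
  B z k = 1 -> exch x B k = x z * \prod_(i | i != z) x i ^+ pz (B i k)
                            + \prod_(i | i != z) x i ^+ pz (- B i k).
Proof.
by move=> Bzk; rewrite /exch !(bigD1_expr _ _ z) Bzk expr1 expr0 mul1r.
Qed.

Lemma prod_expr_neq0 (I : finType) (E : fieldType) (x : I -> E) (P : pred I)
    (e : I -> nat) : (forall i, x i != 0) -> \prod_(i | P i) x i ^+ e i != 0.
Proof. by move=> nx; apply/prodf_neq0 => i _; rewrite expf_neq0. Qed.

Section Commuting.
Variables (I : finType) (B : I -> I -> int) (j k : I).
Hypotheses (jk : j != k) (sB : skewz B) (Bjk : B j k = 0).
Variables (E : fieldType) (x : I -> E).
Let s1 := mut (x, B) k.
Let s2 := mut s1 j.

Let Bkj : B k j = 0.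
Proof.
have := skewz_gt0 k j sB; have := skewz_gt0 j k sB; rewrite Bjk ltxx => h /esym.
by move/esym/negbT; case: (ltrgt0P (B k j)) h.
Qed.

(** Since [B k j = 0], the mutation at [k] keeps column [j], and [x_k] does not occur in the
    exchange binomial of [j]. *)
Lemma commuting_j : s2.1 j = (x j)^-1 * exch x B j.
Proof.
rewrite /= /mutx eqxx /= (negbTE jk); congr (_ * (_ + _)); apply: eq_bigr => i _;
  rewrite /mutb; case: (eqVneq i k) => [->|ik] /=; rewrite ?Bkj ?oppr0 ?expr0 //;
  by rewrite (negbTE jk) /bmul ltxx !andbF addr0.
Qed.

(** The mutation at [j] keeps column [k], whose entry in row [j] is zero, so the second mutation at
    [k] undoes the first. *)
Lemma commuting_k : x k != 0 -> s1.1 k != 0 -> (mut s2 k).1 k = x k.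
Proof.
move=> xk pk; have Bkk := skewz_diag k sB.
have eB i : s2.2 i k = s1.2 i k.
  rewrite /= {1}/mutb [k == j]eq_sym (negbTE jk) orbF; case: (eqVneq i j) => [->|_].
    by rewrite /mutb eqxx orbT Bjk !oppr0.
  by rewrite [mutb B k j k]/mutb eqxx orbT Bjk oppr0 /bmul ltxx !andbF addr0.
have -> : (mut s2 k).1 k = (mut s1 k).1 k.
  rewrite /= {1}/mutx [X in _ = X]/mutx !eqxx /exch.
  have ek : mutx (mutx x B k) (mutb B k) j k = mutx x B k k.
    by rewrite {1}/mutx eq_sym (negbTE jk).
  rewrite ek; congr (_ * (_ + _)); apply: eq_bigr => i _;
    rewrite -[mutb (mutb B k) j i k]/(s2.2 i k) eB /= {1}/mutx; case: (eqVneq i j) => [->|//];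
    by rewrite /mutb eqxx orbT Bjk !oppr0 !expr0.
by rewrite /s1 mutK.
Qed.

End Commuting.

Section Exchange.
Variables (I : finType) (B : I -> I -> int) (j k : I).
Hypotheses (jk : j != k) (sB : skewz B) (Bjk : 0 < B j k).
Let B1 := mutb B k.
Let B2 := mutb B1 j.
Let c := pz (B j k).
Let b := pz (- B k j).

Section Formulas.
Variables (E : fieldType) (x : I -> E) (p : E).

(** Formulas for the variables after the mutations [k], [j], [k]. Here [p] stands for [x_k']; it is
    a separate argument so that it can be put to 0. [exM] and [exN] come from the exchange at [j],
    [exR] and [exQ] from the second exchange at [k], with the powers of [p] and of the new [x_j]
    split off. [exH] is the new [x_j], and [exG] is the new [x_k], namely [exR * exH ^+ c + exQ]
    with the division by [p] carried out. *)
Definition exM := \prod_(i | i != k) x i ^+ pz (B1 i j).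
Definition exN := \prod_i x i ^+ pz (- B1 i j).
Definition exR := \prod_(i | i != j) x i ^+ pz (B2 i k).
Definition exQ := \prod_(i | i != j) x i ^+ pz (- B2 i k).
Definition exD := \prod_i (x i)^-1 ^+ pz (B i k).
Definition exH := (p ^+ b * exM + exN) * (x j)^-1.
Definition exG :=
  exR * (exM * (x j)^-1 * p ^+ b.-1 *
         \sum_(s < c) exH ^+ (c.-1 - s) * (exN * (x j)^-1) ^+ s)
  + exQ * x k * exD.
End Formulas.

Let Bkj : B k j < 0.
Proof. by rewrite -(skewz_gt0 j k sB). Qed.

Let b_gt0 : (0 < b)%N.
Proof. by rewrite /b; case: (B k j) Bkj => // -[]. Qed.

Let B1kj : B1 k j = - B k j. Proof. by rewrite /B1 /mutb eqxx. Qed.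
Let B1jk : B1 j k = - B j k. Proof. by rewrite /B1 /mutb eqxx orbT. Qed.
Let B2jk : B2 j k = B j k. Proof. by rewrite /B2 /mutb eqxx B1jk opprK. Qed.

Let n_k : pz (- B1 k j) = 0%N.
Proof. by rewrite B1kj opprK; case: (B k j) Bkj. Qed.

(** [B1 j k] is negative, so the mutation at [j] corrects column [k] only in rows with
    [B1 i j < 0]. *)
Let B2ik i : i != j -> i != k -> B2 i k = - B i k - (c * pz (- B1 i j))%N%:Z.
Proof.
move=> ij ik; rewrite /B2 {1}/mutb (negbTE ij) [k == j]eq_sym (negbTE jk) /=.
rewrite B1jk {1}/B1 /mutb (negbTE ik) eqxx /=; congr (_ + _).
have -> : (c * pz (- B1 i j))%:Z = c%:Z * (pz (- B1 i j))%:Z by [].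
have nB : (B j k < 0) = false by rewrite ltNge ltW.
have [-> _] := pz_gt0 Bjk; rewrite -/B1 /bmul oppr_gt0 oppr_lt0 Bjk nB andbF andbT.
case: ifP => h; first by have [] := @pz_gt0 (- B1 i j); rewrite ?oppr_gt0 // => -> _; ring.
by case: (B1 i j) h => [[|n]|n] //= _; rewrite mulr0 oppr0.
Qed.

Let B2kk : B2 k k = 0.
Proof. by apply: skewz_diag; do 2!apply: skewz_mutb. Qed.

Section Identity.
Variables (E : fieldType) (x : I -> E).
Let s1 := mut (x, B) k.
Let s2 := mut s1 j.

Lemma exchange_j : s2.1 j = exH x (s1.1 k).
Proof.
rewrite /= {1}/mutx eqxx /= {1}/mutx (negbTE jk) mulrC /exH; congr (_ * _).
rewrite /exch (bigD1_expr _ _ k) -/B1 B1kj; congr (_ * _ + _).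
  by apply: eq_bigr => i ik; rewrite /mutx (negbTE ik).
apply: eq_bigr => i _; rewrite {1}/mutx; case: eqVneq => [->|//].
by rewrite n_k.
Qed.

(** Compare exponents: away from [j] and [k] this is [B2ik], split into positive and negative parts.
    It makes the value of [exR * exH ^+ c + exQ] at [p = 0] a multiple of the exchange binomial of
    [k]. *)
Lemma exchange_monomial : (forall i, x i != 0) ->
  exR x * (exN x * (x j)^-1) ^+ c = exQ x * exD x * \prod_i x i ^+ pz (- B i k).
Proof.
move=> nx; have nP e := prod_expr_neq0 predT e nx.
have -> : exD x = (\prod_i x i ^+ pz (B i k))^-1.
  by rewrite /exD -prodfV; apply: eq_bigr => i _; rewrite exprVn.
rewrite exprMn exprVn.
suff e : exR x * exN x ^+ c * \prod_i x i ^+ pz (B i k) =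
         exQ x * x j ^+ c * \prod_i x i ^+ pz (- B i k).
  have := nP (fun i => pz (B i k)); have := expf_neq0 c (nx j); move: e.
  move: (x j ^+ c) (\prod_i x i ^+ pz (B i k)) => y T e ny nT.
  apply: (mulIf nT); apply: (mulIf ny).
  transitivity (exR x * exN x ^+ c * T); first by field; rewrite ny.
  by rewrite e; field; rewrite nT.
rewrite /exR /exN /exQ [\prod_(i | i != j) _ ^+ pz (B2 i k)]big_mkcond /=.
rewrite [\prod_(i | i != j) _ ^+ pz (- B2 i k)]big_mkcond /=.
have -> : x j ^+ c = \prod_i x i ^+ (if i == j then c else 0%N).
  by rewrite (bigD1_expr _ _ j) eqxx big1 ?mulr1 // => i /negbTE ->.
rewrite -prodrXl -!big_split /=; apply: eq_bigr => i _.
case: (eqVneq i j) => [->|ij] /=.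
  rewrite !mul1r /B1 skewz_diag; last exact: skewz_mutb.
  by have [_ ->] := pz_gt0 Bjk; rewrite oppr0 expr0 expr1n mul1r mulr1.
rewrite -!exprM -!exprD; congr (_ ^+ _).
case: (eqVneq i k) => [->|ik]; first by rewrite B2kk n_k (skewz_diag k sB).
by have := pzB (B2 i k); have := pzB (B i k); rewrite {3}B2ik //; lia.
Qed.

(** With [N = exN / x_j], the difference [exH ^+ c - N ^+ c] is divisible by [exH - N] and so by
    [p], while [exR * N ^+ c + exQ = exQ * exD * exch x B k = exQ * exD * p * x_k] by
    [exchange_monomial]. *)
Lemma exchange_k : (forall i, x i != 0) -> s1.1 k != 0 ->
  (mut s2 k).1 k = exG x (s1.1 k).
Proof.
move=> nx nzp; set p := s1.1 k; apply: (mulfI nzp).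
have -> : p * (mut s2 k).1 k = exR x * exH x p ^+ c + exQ x.
  rewrite [(mut s2 k).1 k]/= {1}/mutx eqxx.
  have -> : mutx s1.1 (mutb B k) j k = p by rewrite {1}/mutx eq_sym (negbTE jk).
  rewrite mulrA mulfV // mul1r /exch (bigD1_expr _ _ j) [X in _ + X](bigD1_expr _ _ j).
  rewrite -/B1 -/B2 B2jk (pz_gt0 Bjk).2 expr0 mul1r mulrC.
  have -> : mutx s1.1 B1 j j = exH x p by exact: exchange_j.
  congr (_ * _ + _); apply: eq_bigr => i ij; rewrite {1}/mutx (negbTE ij) /= /mutx;
    case: (eqVneq i k) => [->|//]; by rewrite B2kk.
rewrite /exG; set N := exN x * _.
have eH : p * (exM x / x j * p ^+ b.-1 * \sum_(s < c) exH x p ^+ (c.-1 - s) * N ^+ s)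
        = exH x p ^+ c - N ^+ c.
  rewrite subrXX mulrA; congr (_ * _).
  have -> : exH x p - N = p ^+ b.-1.+1 * exM x / x j by rewrite prednK // /exH /N; ring.
  by rewrite exprS; ring.
have ep : p * x k = exch x B k by rewrite /p /= /mutx eqxx; field; apply: nx.
transitivity (exR x * (p * (exM x / x j * p ^+ b.-1 *
   \sum_(s < c) exH x p ^+ (c.-1 - s) * N ^+ s)) + exQ x * exD x * (p * x k)).
  rewrite eH ep mulrBr -addrA; congr (_ + _).
  rewrite /exch mulrDr -exchange_monomial // -/N [X in _ = X]addrC addrK.
  rewrite -mulrA /exD -big_split /= big1 ?mulr1 // => i _.
  by rewrite exprVn mulVf // expf_neq0.
by rewrite -[X in _ = X * _]/p; ring.
Qed.

End Identity.

Section ExchangeRel.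
Variables (E0 E1 : fieldType) (W : E0 -> E1 -> Prop) (X : I -> E0) (x : I -> E1).
Hypotheses (rW : ring_rel W) (WX : forall i, W (X i) (x i)).
Hypothesis (WV : forall i, W (X i)^-1 (x i)^-1).

Let WP (P : pred I) (e : I -> nat) :
  W (\prod_(i | P i) X i ^+ e i) (\prod_(i | P i) x i ^+ e i).
Proof. by apply: rrel_prod => // i _; apply: rrelX. Qed.

Lemma exH_rel P p : W P p -> W (exH X P) (exH x p).
Proof.
move=> Pp; apply: (rrelM rW) => //; apply: (rrelD rW); last exact: WP.
by apply: (rrelM rW); [apply: rrelX|apply: WP].
Qed.

Lemma exG_rel P p : W P p -> W (exG X P) (exG x p).
Proof.
move=> Pp; apply: (rrelD rW).
  apply: (rrelM rW); first exact: WP.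
  apply: (rrelM rW).
    by do !apply: (rrelM rW) => //; [apply: WP|apply: rrelX].
  apply: rrel_sum => // s _; apply: (rrelM rW); apply: rrelX => //; first exact: exH_rel.
  by apply: (rrelM rW) => //; apply: WP.
apply: (rrelM rW); first by apply: (rrelM rW) => //; apply: WP.
by apply: rrel_prod => // i _; apply: rrelX.
Qed.

End ExchangeRel.

Lemma exH0 (E : fieldType) (x : I -> E) : exH x 0 = exN x / x j.
Proof. by rewrite /exH expr0n eqn0Ngt b_gt0 mul0r add0r. Qed.

Lemma exH0_neq0 (E : fieldType) (x : I -> E) :
  (forall i, x i != 0) -> exH x 0 != 0.
Proof. by move=> nx; rewrite exH0 mulf_neq0 ?invr_eq0 // prod_expr_neq0. Qed.

(* At [x_i = +-1] for [i != k] and [x_k = c + 1], the two summands of [exG x 0]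
   have absolute values at most [c] and exactly [c + 1]. *)
Lemma exG0_neq0 (x : I -> rat) : x k = c%:R + 1 ->
  (forall i, i != k -> `|x i| = 1) -> exG x 0 != 0.
Proof.
move=> xk x1.
have nP (P : pred I) (e : I -> nat) :
    (P k -> e k = 0%N) -> `|\prod_(i | P i) x i ^+ e i| = 1.
  move=> ek; rewrite normr_prod big1 // => i Pi; rewrite normrX.
  by case: (eqVneq i k) Pi => [-> /ek ->|ik _]; rewrite ?expr0 // x1 // expr1n.
have nM : `|exM x| = 1 by apply: nP => /eqP.
have nN : `|exN x| = 1 by apply: nP => _; apply: n_k.
have nR : `|exR x| = 1 by apply: nP => _; rewrite B2kk.
have nQ : `|exQ x| = 1 by apply: nP => _; rewrite B2kk.
have nD : `|exD x| = 1.
  rewrite /exD normr_prod big1 // => i _; rewrite normrX normrV ?unitfE.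
  case: (eqVneq i k) => [->|ik]; first by rewrite (skewz_diag k sB) expr0.
  by rewrite x1 // invr1 expr1n.
  case: (eqVneq i k) => [->|ik]; first by rewrite xk natr1 pnatr_eq0.
  by rewrite -normr_gt0 x1.
have nj : `|(x j)^-1| = 1 by rewrite normfV x1 ?invr1.
rewrite /exG exH0; set A := exR x * _; set C := exQ x * _ * _.
have nC : `|C| = c%:R + 1.
  by rewrite /C !normrM nQ nD mul1r mulr1 xk natr1 normr_nat.
have nA : `|A| <= c%:R.
  rewrite /A !normrM nR nM nj !mul1r.
  apply: (@le_trans _ _ (1 * c%:R)); last by rewrite mul1r.
  (* The factor [0 ^+ b.-1] is 1 if [b = 1] and 0 otherwise. *)
  apply: ler_pM => //; first by rewrite normrX normr0 expr0n; case: eqP.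
  apply: (le_trans (ler_norm_sum _ _ _)).
  rewrite (eq_bigr (fun=> 1)) ?sumr_const ?card_ord // => s _.
  by rewrite normrM !normrX normrM nN nj mulr1 !expr1n.
apply/eqP => e0; have : `|C| = `|A| by rewrite -[C]opprK normrN (_ : - C = A) //; lra.
by rewrite nC => eA; move: nA; rewrite -eA; lra.
Qed.

End Exchange.

(** * The Laurent phenomenon *)

Lemma mutsN (I : finType) (E : fieldType) (x : I -> E) B w :
  (muts (x, fun i j => - B i j) w).1 = (muts (x, B) w).1.
Proof.
by elim: w x B => [|k w IH] x B //=; rewrite {1}/mut /= mutxN mutbN IH.
Qed.

Lemma genX_neq0 (I : finType) (i : I) : genX i != 0.
Proof. exact: nonvanishing0 i (nonvanishing_genX (fun _ _ => 0) [::]). Qed.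

Lemma exch_genX_neq0 (I : finType) (B : I -> I -> int) k : exch (@genX I) B k != 0.
Proof.
have := nonvanishing_muts k (nonvanishing_genX B [:: k]).
by rewrite /= /mutx eqxx mulf_eq0 negb_or => /andP[].
Qed.

(* If the exchange polynomial of [k] vanishes at [x], then the specialisation at [x]
   keeps the [j]- and [k]-variables of [mu_k mu_j mu_k] nonzero: the latter are prime
   to [x_k']. *)
Lemma third_mutation_coprime (I : finType) (B : I -> I -> int) (j k z : I)
    (x : I -> genK I) :
  j != k -> z != k -> skewz B -> B z j = 0 -> (forall i, i != z -> x i = genX i) ->
  (forall q : I -> rat, (forall i, i != k -> q i = 1) -> gspec q (x z) (-1)) ->
  exch x B k = 0 ->
  let y := (muts (@genX I, B) [:: k; j; k]).1 in
  [/\ laurent (@genX I) (y j), laurent (@genX I) (y k) &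
      exists2 d, gspec x (y j * y k) d & d != 0].
Proof.
(* Negating [B] swaps the two exchange monomials and changes no variable, so [B j k >= 0] may be
   assumed. *)
move=> jk zk; wlog Bjk : B / 0 <= B j k.
  move=> W sB Bzj xX xz x0; case: (leP 0 (B j k)) => Bjk; first exact: (W B).
  have := W (fun i j => - B i j); rewrite exchN mutsN; apply=> //.
  - by rewrite oppr_ge0 ltW.
  - exact: skewzN.
  - by rewrite Bzj oppr0.
move=> sB Bzj xX xz x0; set X := @genX I; set y := (muts _ _).1; cbv zeta.
have nx i : x i != 0.
  case: (eqVneq i z) => [->|iz]; last by rewrite xX // genX_neq0.
  by apply: (gspec_neq0 (xz (fun=> 1) _)).
have gX := gspecX x; have gR := gspec_ring x.
have gV i : gspec x (X i)^-1 (x i)^-1 by apply: gspecV.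
have e3j : y j = (muts (X, B) [:: k; j]).1 j by rewrite /y /= {1}/mutx (negbTE jk).
case: (eqVneq (B j k) 0) => [B0|Bn0].
  have ej : y j = (X j)^-1 * exch X B j by rewrite e3j; apply: commuting_j.
  have ek : y k = X k.
    apply: commuting_k => //; first exact: genX_neq0.
    by apply: nonvanishing_muts k (nonvanishing_genX B [:: k]).
  rewrite ej ek; split.
  - by apply: laurentM; [apply: laurent_inv|apply: laurent_exch].
  - exact: laurent_var.
  - exists ((x j)^-1 * exch x B j * x k).
      by apply: (rrelM gR) => //; apply: (rrelM gR) => //; apply: exch_rel.
    rewrite !mulf_neq0 ?invr_eq0 //.
    (* [x_z] does not occur in the exchange binomial of [j], and [x] is generic elsewhere. *)
    suff -> : exch x B j = exch X B j by apply: exch_genX_neq0.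
    congr (_ + _); apply: eq_bigr => i _; case: (eqVneq i z) => [->|iz];
      by rewrite ?Bzj ?oppr0 ?expr0 // xX.
have {Bn0}Bjk : 0 < B j k by rewrite lt_neqAle eq_sym Bn0.
set p := (mut (X, B) k).1 k.
have np : p != 0 by apply: nonvanishing_muts k (nonvanishing_genX B [:: k]).
(* The exchange binomial vanishes at [x], so [exH] and [exG] are to be evaluated at [p = 0]. *)
have gp : gspec x p 0.
  have := mutx_rel gR (@gspecV _ _ x) B gX (nx k) k.
  by rewrite {2}/mutx eqxx x0 mulr0.
have ej : y j = exH B j k X p by rewrite e3j; apply: exchange_j.
have ek : y k = exG B j k X p by rewrite -(exchange_k jk sB Bjk (@genX_neq0 I) np).
have Lp : laurent X p by apply: laurent_mutx.
have lR := laurent_ring X rat.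
have lX i : laurent X (X i) by apply: laurent_var.
have lV i : laurent X (X i)^-1 by apply: laurent_inv.
rewrite ej ek; split.
- exact: (@exH_rel _ B j k _ _ _ X (fun=> 0) lR lX lV p 0).
- exact: (@exG_rel _ B j k _ _ _ X (fun=> 0) lR lX lV p 0).
- exists (exH B j k x 0 * exG B j k x 0).
    by apply: (rrelM gR); [apply: exH_rel|apply: exG_rel].
  apply: mulf_neq0; first exact: (exH0_neq0 sB Bjk nx).
  pose c := pz (B j k).
  (* A further specialisation to the rationals, with [x_z] going to -1, [x_k] to [c + 1] and the
     rest to 1: a point to which [exG0_neq0] applies. *)
  pose q (i : I) : rat := if i == k then c%:R + 1 else 1.
  pose x' i := if i == z then -1 else q i.
  have q1 i : i != k -> q i = 1 by rewrite /q => /negbTE ->.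
  have gq i : gspec q (x i) (x' i).
    rewrite /x'; case: (eqVneq i z) => [->|iz]; first exact: xz.
    by rewrite xX //; apply: gspecX.
  have nx' i : x' i != 0.
    rewrite /x' /q; case: ifP => // _; case: ifP => // _.
    by rewrite natr1 pnatr_eq0.
  have gG : gspec q (exG B j k x 0) (exG B j k x' 0).
    apply: exG_rel => //; first exact: gspec_ring.
      by move=> i; apply: gspecV.
    exact: (rrel0 (gspec_ring q)).
  apply: (gspec_neq0 gG); apply: (exG0_neq0 jk sB Bjk).
    by rewrite /x' eq_sym (negbTE zk) /q eqxx.
  move=> i ik; rewrite /x'; case: ifP => _; first by rewrite normrN1.
  by rewrite q1 // normr1.
Qed.

(** The factor theorem for substituting [x z] for [X z]. An inverse contributes [1/X_z - 1/x_z = -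
    (X_z - x_z) / (X_z x_z)], so [x z] has to be a Laurent unit. *)
Lemma evl_sub_factor (I : finType) (E : fieldType) (X x : I -> E) (z : I) e :
  X z != 0 -> x z != 0 -> (forall i, i != z -> x i = X i) ->
  laurent X (x z) -> laurent X (x z)^-1 ->
  laurent X (evl x e) /\
  exists2 g, laurent X g & evl X e - evl x e = (X z - x z) * g.
Proof.
move=> nX nx xX Lz LV.
have L0 : laurent X 0 by apply: (laurentC X 0).
elim: e => [c|i|i|e [IH [g Lg eg]] e' [IH' [g' Lg' eg']]
  |e [IH [g Lg eg]] e' [IH' [g' Lg' eg']]] /=.
- by split; [apply: laurentC|exists 0 => //; rewrite subrr mulr0].
- case: (eqVneq i z) => [->|/xX ->].
    by split=> //; exists 1; [apply: (laurentC X 1)|rewrite mulr1].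
  by split; [apply: laurent_var|exists 0 => //; rewrite subrr mulr0].
- case: (eqVneq i z) => [->|/xX ->].
    split=> //; exists (- ((X z)^-1 * (x z)^-1)).
      by apply: laurentN; apply: laurentM => //; apply: laurent_inv.
    by field; rewrite nX nx.
  by split; [apply: laurent_inv|exists 0 => //; rewrite subrr mulr0].
- split; first exact: laurentD.
  by exists (g + g'); [apply: laurentD|rewrite mulrDr -eg -eg'; ring].
- split; first exact: laurentM.
  exists (evl X e * g' + g * evl x e').
    by apply: laurentD; apply: laurentM => //; exists e.
  by rewrite mulrDr mulrCA -eg' mulrA -eg; ring.
Qed.

(** Each inverse in the expression costs at most one factor [D]; sums and products add the
    exponents. *)
Lemma evl_clear_denominator (I : finType) (E : fieldType) (X Y : I -> E) (D : E) e :
  laurent X D -> (forall i, laurent X (Y i)) ->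
  (forall i, laurent X ((Y i)^-1 * D)) -> exists a, laurent X (evl Y e * D ^+ a).
Proof.
move=> LD LY LV; elim: e => [c|i|i|e [a IH] e' [a' IH']|e [a IH] e' [a' IH']] /=.
- by exists 0%N; rewrite mulr1; apply: laurentC.
- by exists 0%N; rewrite mulr1.
- by exists 1%N.
- exists (a + a')%N; rewrite mulrDl exprD mulrA [D ^+ a * _]mulrC mulrA.
  by apply: laurentD; apply: laurentM => //; apply: laurentX.
- exists (a + a')%N; rewrite exprD mulrACA; exact: laurentM.
Qed.

(** One expression serves all fields and points, because the induction applies it to mutated
    clusters and to points where an adjoined variable is 1. *)
Definition laurent_word (I : finType) (w : seq I) :=
  forall B : I -> I -> int, skewz B -> forall i, exists e : lexpr I,
  forall (E : fieldType) (x : I -> E), nonvanishing (x, B) w ->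
    (muts (x, B) w).1 i = evl x e.

(** Both sides specialise from the generic point to [x], and a specialisation has only one value. *)
Lemma laurent_word_genX (I : finType) (B : I -> I -> int) w i :
  laurent (@genX I) ((muts (@genX I, B) w).1 i) -> exists e : lexpr I,
  forall (E : fieldType) (x : I -> E), nonvanishing (x, B) w ->
    (muts (x, B) w).1 i = evl x e.
Proof.
move=> [e ee]; exists e => E x nv; apply: (@gspec_fun _ _ x (evl (@genX I) e)).
  rewrite -ee; apply: muts_rel; [exact: gspec_ring|exact: gspecV|exact: gspecX|].
  exact: nonvanishing_mutable.
by apply: gspec_evl => y; apply: nonvanishing0 y nv.
Qed.

(* With an index [z] of [b_zk = 1] that is linked to [k] only, the exchange polynomial
   of [k] is linear in [x_z], hence prime. *)
Lemma laurent_step (I : finType) (B : I -> I -> int) (j k z : I) w i :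
  j != k -> skewz B -> B z k = 1 -> B z j = 0 ->
  laurent_word (j :: w) -> laurent_word (k :: w) ->
  laurent (@genX I) ((muts (@genX I, B) [:: k, j & w]).1 i).
Proof.
move=> jk sB Bzk Bzj IHj IHk; set X := @genX I.
have zk : z != k by apply: contra_eq_neq Bzk => ->; rewrite (skewz_diag k sB).
pose s1 := mut (X, B) k; pose s2 := mut s1 j; pose s3 := mut s2 k.
have s3E : s3 = muts (X, B) [:: k; j; k] by [].
have nv w' : nonvanishing (X, B) w' by apply: nonvanishing_genX.
have sB1 : skewz s1.2 by apply: skewz_mutb.
have sB2 : skewz s2.2 by apply: skewz_mutb.
have sB3 : skewz s3.2 by apply: skewz_mutb.
have nv2 w' : nonvanishing s2 w' by have [_ [_]] := nv [:: k, j & w'].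
have s2E : mut s3 k = s2.
  by apply: (@mutK_nonvanishing _ _ s2.1 s2.2 k [::]); [apply: skewz_diag|apply: nv2].
set y := (muts _ _).1 i.
have [e1 y1] : exists e, y = evl s1.1 e.
  have [e He] := IHj s1.2 sB1 i; exists e; rewrite -He //.
  by have [_] := nv [:: k, j & w].
(* As [mu_k] returns from [s3] to [s2], the word [k :: w] leads from [s3] to [y]. *)
have [e3 y3] : exists e, y = evl s3.1 e.
  have [e He] := IHk s3.2 sB3 i; exists e; rewrite -He.
    rewrite -[muts (s3.1, s3.2) _]/(muts (mut s3 k) w); by rewrite s2E.
  by rewrite -[(s3.1, s3.2)]/s3; have [_ []] := nv2 [:: k, k & w].
pose M1 := \prod_(i | i != z) X i ^+ pz (B i k).
pose M2 := \prod_(i | i != z) X i ^+ pz (- B i k).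
have nM e := prod_expr_neq0 (fun i => i != z) e (@genX_neq0 I).
have LM (e : I -> nat) : laurent X (\prod_(i | i != z) X i ^+ e i).
  by apply: laurent_prod => l _; apply: laurentX; apply: laurent_var.
have LMV (e : I -> nat) : laurent X (\prod_(i | i != z) X i ^+ e i)^-1.
  rewrite -prodfV; apply: laurent_prod => l _; rewrite -exprVn.
  by apply: laurentX; apply: laurent_inv.
(* [z0] is the root of the exchange binomial of [k], which is linear in [x_z]; evaluating at [x] is
   reduction modulo this binomial. *)
pose z0 := - (M2 / M1); pose x l := if l == z then z0 else X l.
have xz : x z = z0 by rewrite /x eqxx.
have xX l : l != z -> x l = X l by rewrite /x => /negbTE ->.
have nz0 : z0 != 0 by rewrite oppr_eq0 mulf_neq0 ?invr_eq0 ?nM.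
have exE (t : I -> genK I) : (forall l, l != z -> t l = X l) ->
    exch t B k = M1 * (t z - z0).
  move=> tX; rewrite (exch_linear _ Bzk).
  have -> : \prod_(i | i != z) t i ^+ pz (B i k) = M1.
    by apply: eq_bigr => l lz; rewrite tX.
  have -> : \prod_(i | i != z) t i ^+ pz (- B i k) = M2.
    by apply: eq_bigr => l lz; rewrite tX.
  by rewrite mulrC /z0 opprK mulrDr; congr (_ + _); rewrite mulrC divfK ?nM.
set p := s1.1 k.
have ep : p = (X k)^-1 * (M1 * (X z - z0)) by rewrite /p /= /mutx eqxx exE.
have np : p != 0 by apply: nonvanishing_muts k (nv [:: k]).
have Lp : laurent X p by apply: laurent_mutx.
have [] := @third_mutation_coprime I B j k z x jk zk sB Bzj xX.
(* [M1] and [M2] do not contain [x_k], so both become 1 at [q], and [z0] becomes -1. *)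
- move=> q q1; rewrite xz.
  have gM (e : I -> nat) : e k = 0%N -> gspec q (\prod_(i | i != z) X i ^+ e i) 1.
    move=> ek; have -> : 1 = \prod_(i | i != z) q i ^+ e i.
      rewrite big1 // => l _; case: (eqVneq l k) => [->|lk]; first by rewrite ek.
      by rewrite q1 // expr1n.
    apply: (rrel_prod (gspec_ring q)) => l _; apply: (rrelX (gspec_ring q)).
    exact: gspecX.
  have gM1 : gspec q M1 1 by apply: gM; rewrite (skewz_diag k sB).
  have gM2 : gspec q M2 1 by apply: gM; rewrite (skewz_diag k sB).
  have := rrelM (gspec_ring q) (gspecC q (-1))
    (rrelM (gspec_ring q) gM2 (gspecV (oner_neq0 _) gM1)).
  by rewrite invr1 !mulr1 -[(-1)%:~R in X in gspec _ X _]/(-1) mulN1r.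
- by rewrite exE // xz subrr mulr0.
rewrite -/X -s3E; set D := s3.1 j * s3.1 k => Lj Lk [d gD nd].
have nx l : x l != 0 by rewrite /x; case: ifP => // _; apply: genX_neq0.
have gp : gspec x p 0.
  have := mutx_rel (gspec_ring x) (@gspecV _ _ x) B (gspecX x) (nx k) k.
  by rewrite [X in gspec _ _ X]/mutx eqxx exE // xz subrr !mulr0.
have n3 l : s3.1 l != 0 by apply: nonvanishing_muts l (nv2 [:: k]).
have s3X l : l != j -> l != k -> s3.1 l = X l.
  by move=> /negbTE lj /negbTE lk; rewrite /= /mutx lk lj.
have LD : laurent X D by apply: laurentM.
(* Over the Laurent polynomials in [X], the first expansion of [y] has a power of [p] as
   denominator, the second a power of [D]. *)
have [a LA] : exists a, laurent X (y * p ^+ a).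
  rewrite y1; apply: evl_clear_denominator => // l; first exact: laurent_mutx.
  case: (eqVneq l k) => [->|lk]; first by rewrite mulVf //; apply: (laurentC X 1).
  rewrite /= {1}/mutx (negbTE lk).
  by apply: laurentM => //; apply: laurent_inv.
have [b LC] : exists b, laurent X (y * D ^+ b).
  rewrite y3; apply: evl_clear_denominator => // l.
    case: (eqVneq l j) => [->//|lj]; case: (eqVneq l k) => [->//|lk].
    by rewrite s3X //; apply: laurent_var.
  case: (eqVneq l j) => [->|lj]; first by rewrite mulKf.
  case: (eqVneq l k) => [->|lk]; first by rewrite /D mulrCA mulVf // mulr1.
  by rewrite s3X //; apply: laurentM => //; apply: laurent_inv.
(* [p] is prime and prime to [D], so the factors [p] cancel one by one until [a = 0]. *)
elim: a LA => [|a IH] LA; first by rewrite mulr1 in LA.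
apply: IH; have [e eA] := LA; have [e' eC] := LC.
have gA := gspec_evl e nx; have gC := gspec_evl e' nx.
have [_ [g Lg eg]] : laurent X (evl x e) /\
    exists2 g, laurent X g & evl X e - evl x e = (X z - x z) * g.
  apply: evl_sub_factor; rewrite ?xz //; first exact: genX_neq0.
    by apply: laurentN; apply: laurentM; [apply: LM|apply: LMV].
  by rewrite invrN invf_div; apply: laurentN; apply: laurentM; [apply: LM|apply: LMV].
(* [y * p ^+ a.+1 * D ^+ b] has the value [evl x e * d ^+ b] by the first expansion and, through its
   factor [p], the value 0 by the second; [d] is nonzero. *)
have e0 : evl x e = 0.
  apply/eqP; suff : evl x e * d ^+ b == 0.
    by rewrite mulf_eq0 expf_eq0 (negbTE nd) andbF orbF.
  apply/eqP; apply: (@gspec_fun _ _ x (y * p ^+ a.+1 * D ^+ b)).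
    rewrite eA; apply: (rrelM (gspec_ring x)) => //; exact: (rrelX (gspec_ring x)).
  have -> : y * p ^+ a.+1 * D ^+ b = (y * D ^+ b) * p ^+ a * p by rewrite exprS; ring.
  rewrite eC -(mulr0 (evl x e' * 0 ^+ a)); apply: (rrelM (gspec_ring x)) => //.
  by apply: (rrelM (gspec_ring x)) => //; apply: (rrelX (gspec_ring x)).
(* [p] and [X z - z0] differ by the Laurent unit [M1 / X_k], so one factor [p] divides out. *)
have -> : y * p ^+ a = X k * M1^-1 * g.
  apply: (mulIf np); transitivity (y * p ^+ a.+1); first by rewrite exprSr mulrA.
  have -> : y * p ^+ a.+1 = (X z - z0) * g by rewrite eA -xz -eg e0 subr0.
  by rewrite ep; field; rewrite genX_neq0 nM.
by apply: laurentM => //; apply: laurentM; [apply: laurent_var|apply: LMV].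
Qed.

Lemma big_optionE (E : fieldType) (I : finType) (F : option I -> E) :
  \prod_o F o = F None * \prod_i F (Some i).
Proof.
rewrite (bigD1 None) //=; congr (_ * _).
rewrite (reindex_omap Some id) /=; last by case.
by apply: eq_bigl => i; rewrite eqxx.
Qed.

(** * Adjoining a frozen variable *)

Section Adjoin.
Variables (I : finType) (k : I).

(** [None] is the new index; its column is the negative of its row, so it takes the multiplier of
    [k] in the skew-symmetrization. *)
Definition adjoin_mx (B : I -> I -> int) (o o' : option I) : int :=
  match o, o' with
  | Some i, Some j => B i j
  | None, Some j => (j == k)%:Z
  | Some i, None => - (i == k)%:Z
  | None, None => 0
  end.

Lemma skewz_adjoin B : skewz B -> skewz (adjoin_mx B).
Proof.
case=> d d0 dB; exists (fun o => if o is Some i then d i else d k).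
  by case.
case=> [i|] [j|] //=; last by rewrite !mulr0 oppr0.
- by case: eqVneq => [->|_]; rewrite ?mulr0 ?mulrN.
- by case: eqVneq => [->|_]; rewrite ?mulr0 ?oppr0 ?mulrN ?opprK.
Qed.

Section Extends.
Variable E : fieldType.

Definition extends (s' : (option I -> E) * (option I -> option I -> int))
    (s : (I -> E) * (I -> I -> int)) :=
  [/\ forall i, s'.1 (Some i) = s.1 i, s'.1 None = 1
    & forall i j, s'.2 (Some i) (Some j) = s.2 i j].

(** The variable at [None] is 1, so its powers drop out of every exchange, and entries between old
    indices change by old entries only. *)
Lemma extends_mut s' s j : extends s' s -> extends (mut s' (Some j)) (mut s j).
Proof.
case=> ex e1 eB; split=> [i| |i l] /=.
- rewrite /mutx (inj_eq (@Some_inj _)) ex ex; case: ifP => // _; congr (_ * _).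
  rewrite /exch !big_optionE e1 !expr1n !mul1r; congr (_ + _);
    by apply: eq_bigr => l _; rewrite ex eB.
- by rewrite /mutx.
- by rewrite /mutb !(inj_eq (@Some_inj _)) !eB.
Qed.

Lemma extends_muts s' s w : extends s' s ->
  extends (muts s' [seq Some i | i <- w]) (muts s w).
Proof. by elim: w s' s => [|j w IH] s' s //= /(extends_mut j) /IH. Qed.

Lemma extends_nonvanishing s' s w : extends s' s -> nonvanishing s w ->
  nonvanishing s' [seq Some i | i <- w].
Proof.
elim: w s' s => [|j w IH] s' s es [ns nw]; have [e e1 _] := es.
  by split=> // -[i|]; rewrite ?e ?e1 ?oner_neq0.
split; first by case=> [i|]; rewrite ?e ?e1 ?oner_neq0.
by apply: IH nw; apply: extends_mut.
Qed.

End Extends.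

Fixpoint lexpr_restrict (e : lexpr (option I)) : lexpr I :=
  match e with
  | Cst c => Cst I c
  | Var o => if o is Some i then Var i else Cst I 1
  | Inv o => if o is Some i then Inv i else Cst I 1
  | Add e1 e2 => Add (lexpr_restrict e1) (lexpr_restrict e2)
  | Mul e1 e2 => Mul (lexpr_restrict e1) (lexpr_restrict e2)
  end.

Lemma evl_restrict (E : fieldType) (x : I -> E) e :
  evl x (lexpr_restrict e) = evl (fun o => if o is Some i then x i else 1) e.
Proof. by elim: e => //= [[i|]|[i|]|e -> e' ->|e -> e' ->] //=; rewrite ?invr1. Qed.

End Adjoin.

(** Strong induction on the length. Words of length at most one are immediate and a repeated first
    letter cancels; otherwise a variable is adjoined at [k], and [laurent_step] reduces to two words
    that are shorter by one. *)
Theorem laurent_phenomenon (I : finType) (w : seq I) : laurent_word w.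
Proof.
have [n] := ubnP (size w); elim: n I w => // n IH I [|k [|j w]] /= sz B sB i.
- by exists (Var i).
- by apply: laurent_word_genX; apply: laurent_mutx.
have [->|jk] := eqVneq j k.
  have [e He] := IH I w (ltnW sz) B sB i; exists e => E x nv; rewrite -He.
    rewrite -[muts _ [:: k, k & w]]/(muts (mut (mut (x, B) k) k) w).
    by rewrite (mutK_nonvanishing _ nv) // skewz_diag.
  have [_ [_ nw]] := nv; rewrite -(mutK_nonvanishing _ nv) ?skewz_diag //.
pose B' := adjoin_mx k B; pose J := option I.
have [e He] : exists e : lexpr J, forall (E : fieldType) (x : J -> E),
    nonvanishing (x, B') [seq Some l | l <- [:: k, j & w]] ->
    (muts (x, B') [seq Some l | l <- [:: k, j & w]]).1 (Some i) = evl x e.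
  apply: laurent_word_genX; apply: (laurent_step (z := None)).
  - by rewrite (inj_eq (@Some_inj _)).
  - exact: skewz_adjoin.
  - by rewrite /= eqxx.
  - by rewrite /= (negbTE jk).
  - by apply: IH; rewrite /= size_map.
  - by apply: IH; rewrite /= size_map.
(* Putting the adjoined variable to 1 turns an expression over [option I] into one over [I]. *)
exists (lexpr_restrict e) => E x nv; rewrite evl_restrict.
set x' := fun o => _; have ex : extends (x', B') (x, B) by [].
by rewrite -He; [case: (extends_muts [:: k, j & w] ex)|apply: extends_nonvanishing ex nv].
Qed.

(** * Units of Laurent polynomial rings *)

Section MonomialFactors.
Variables (K : idomainType) (m : nat).
Implicit Types (P Q : {mpoly K[m]}) (a : 'X_{1..m}).

Let kill (i : 'I_m) : {mpoly K[m]} -> {mpoly K[m]} :=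
  mmap (@mpolyC m K) (fun l => if l == i then 0 else 'X_l).

Let kill_mono i a : kill i 'X_[a] = if a i == 0%N then 'X_[a] else 0.
Proof.
rewrite /kill mmapX /mmap1; case: eqP => [ai|/eqP ai].
  rewrite mpolyXE_id; apply: eq_bigr => l _; case: eqP => [->|//].
  by rewrite ai !expr0.
by rewrite (bigD1 i) //= eqxx expr0n (negbTE ai) mul0r.
Qed.

Let kill_factor i P : exists P', P - kill i P = 'X_i * P'.
Proof.
rewrite [P]mpolyE /kill rmorph_sum /= -sumrB -/(kill i).
apply: (big_ind (fun Q => exists P', Q = 'X_i * P')) => [|_ _ [A ->] [A' ->]|a _].
- by exists 0; rewrite mulr0.
- by exists (A + A'); rewrite mulrDr.
have -> : kill i (P@_a *: 'X_[a]) = P@_a *: kill i 'X_[a] by rewrite /kill mmapZ mul_mpolyC.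
rewrite kill_mono; case: eqP => [_|/eqP ai]; first by exists 0; rewrite subrr mulr0.
exists (P@_a *: 'X_[a - U_(i)]); rewrite scaler0 subr0 -scalerAr -mpolyXD; congr (_ *: 'X_[_]).
apply/mnmP => l; rewrite mnmDE mnmBE mnm1E; case: eqP => [<-|_]; last by rewrite subn0.
by rewrite subnKC // lt0n.
Qed.

(** Induction on the degree. If [X_i] divides the monomial, then [kill i P * kill i Q = 0] in a
    domain, so [X_i] divides [P] or [Q] and cancels; in degree 0, [P] is a unit and hence a
    constant. *)
Lemma mpoly_factor_monomial P Q a : P * Q = 'X_[a] ->
  exists (c : K) (b : 'X_{1..m}), c \is a GRing.unit /\ P = c *: 'X_[b].
Proof.
have [n] := ubnP (mdeg a); elim: n P Q a => // n IH P Q a dega ePQ.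
have [a0|/existsP[i ai]] := altP (@forallP 'I_m (fun i => a i == 0%N)).
  have ea : a = 0%MM by apply/mnmP => i; rewrite mnm0E; apply/eqP; apply: a0.
  move: ePQ; rewrite ea mpolyX0 mulrC => /mpoly_intro_unit /andP[/eqP eP uP].
  by exists P@_0, 0%MM; split; rewrite ?mpolyX0 ?alg_mpolyC.
have ea : a = (U_(i) + (a - U_(i)))%MM.
  apply/mnmP => l; rewrite mnmDE mnmBE mnm1E; case: eqP => [<-|_]; last by rewrite subn0.
  by rewrite subnKC // lt0n.
have dega' : (mdeg (a - U_(i)) < n)%N.
  by move: dega; rewrite {1}ea mdegD mdeg1.
have : kill i P * kill i Q = 0.
  by rewrite /kill -rmorphM /= ePQ -/(kill i _) kill_mono (negbTE ai).
have nX : 'X_i != 0 :> {mpoly K[m]} by rewrite -msupp_eq0 msuppX.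
move/eqP; rewrite mulf_eq0 => /orP[] /eqP k0.
  have [P'] := kill_factor i P; rewrite k0 subr0 => eP.
  have /(IH _ _ _ dega') [c [b [uc eP']]] : P' * Q = 'X_[a - U_(i)].
    by apply: (mulfI nX); rewrite mulrA -eP ePQ -mpolyXD -ea.
  by exists c, (U_(i) + b)%MM; rewrite eP eP' mpolyXD scalerAr.
have [Q'] := kill_factor i Q; rewrite k0 subr0 => eQ.
apply: (IH P Q' _ dega'); apply: (mulfI nX).
by rewrite mulrCA -eQ ePQ -mpolyXD -ea.
Qed.

End MonomialFactors.

(** * Completing the exchange matrix to a square one *)

Section SquareExtension.
Variables (m n : nat) (nm : (n <= m)%N).
Implicit Types (B : 'M[int]_(m, n)) (C : 'I_m -> 'I_m -> int).

Definition extends_mx B C := forall i j, C i (widen_ord nm j) = B i j.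

Let widen_eq (i j : 'I_n) : (widen_ord nm i == widen_ord nm j) = (i == j).
Proof. by rewrite -!val_eqE. Qed.

Lemma extends_mut_B B C k : extends_mx B C ->
  extends_mx (mut_B nm B k) (mutb C (widen_ord nm k)).
Proof. by move=> BC i j; rewrite mxE /mutb widen_eq !BC bmulE. Qed.

Lemma mut_xE (K : idomainType) (x : 'I_m -> ratfun K m) B C k : extends_mx B C ->
  mut_x nm x B k = mutx x C (widen_ord nm k).
Proof.
move=> BC; apply: functional_extensionality => s; rewrite /mut_x /mutx.
case: eqP => [->|//]; congr (_ * (_ + _)); rewrite big_mkcond; apply: eq_bigr => i _;
  by rewrite BC; case: (B i k) => [[|b]|b].
Qed.

Lemma mut_equiv_word (K : idomainType) (x : 'I_m -> ratfun K m) B C t :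
  extends_mx B C -> mut_equiv nm (x, B) t ->
  exists w : seq 'I_m, (forall i, i \in w -> (i < n)%N) /\
    (muts (x, C) w).1 = t.1 /\ extends_mx t.2 (muts (x, C) w).2.
Proof.
move=> BC; elim=> [|s k _ [w [wn [ex eC]]]]; first by exists [::].
exists (rcons w (widen_ord nm k)); split.
  by move=> i; rewrite mem_rcons inE => /orP[/eqP ->|/wn //]; apply: (ltn_ord k).
rewrite /muts -cats1 foldl_cat -[foldl _ _ w]/(muts _ w) /= ex; split.
  by rewrite (mut_xE _ _ eC).
exact: extends_mut_B.
Qed.

Lemma square_extension B : skew_symmetrizable (principal nm B) ->
  exists2 C, extends_mx B C & skewz C.
Proof.
move=> [d [d0 dB]].
pose C (i j : 'I_m) : int :=
  if insub (val j) is Some j' then B i j'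
  else if insub (val i) is Some i' then - (\prod_(l | l != i') d l) * B j i' else 0.
have insubW (i : 'I_m) : (exists2 i' : 'I_n, insub (val i) = Some i' & i = widen_ord nm i')
    \/ insub (val i) = None :> option 'I_n.
  by case: insubP => [i' _ ei|_]; [left; exists i' => //; apply: val_inj|right].
exists C.
  by move=> i j; rewrite /C /= (valK j).
exists (fun i => if insub (val i) is Some i' then d i' else \prod_l d l).
  by move=> i; case: insubP => // _; apply: prodr_gt0.
have dD i : \prod_l d l = d i * \prod_(l | l != i) d l by rewrite (bigD1 i).
move=> i j; rewrite /C.
case: (insubW i) => [[i' -> ei]|->]; case: (insubW j) => [[j' -> ej]|->].
- by have := dB i' j'; rewrite !mxE -ei -ej.
- by rewrite (dD i'); ring.
- by rewrite (dD j'); ring.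
- by rewrite !mulr0 oppr0.
Qed.

End SquareExtension.

Lemma mmap_rel (K : idomainType) (m : nat) (F0 F1 : fieldType) (W : F0 -> F1 -> Prop)
    (h0 : K -> F0) (h1 : K -> F1) X x (P : {mpoly K[m]}) :
  ring_rel W -> (forall c, W (h0 c) (h1 c)) -> (forall i, W (X i) (x i)) ->
  W (mmap h0 X P) (mmap h1 x P).
Proof.
move=> rW Wh Wx; apply: (rrel_sum rW) => a _; apply: (rrelM rW) => //.
by apply: (rrel_prod rW) => i _; apply: rrelX.
Qed.

Lemma rrel_exprz (F0 F1 : fieldType) (W : F0 -> F1 -> Prop) a c (n : int) :
  ring_rel W -> (forall a c, c != 0 -> W a c -> W a^-1 c^-1) ->
  c != 0 -> W a c -> W (a ^ n) (c ^ n).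
Proof.
move=> rW WV nc ac; case: n => n; first exact: (rrelX rW).
by apply: WV; [rewrite expf_neq0|apply: (rrelX rW)].
Qed.

Lemma expfzB (F : fieldType) (x : F) (a b : nat) : x != 0 ->
  x ^ (a%:Z - b%:Z) = x ^+ a / x ^+ b.
Proof. by move=> nx; rewrite expfzDr // -invr_expz. Qed.

Lemma prod_exprzN (F : fieldType) (I : finType) (P : pred I) (x : I -> F) (e : I -> int) :
  (forall i, x i != 0) -> \prod_(i | P i) x i ^ e i * \prod_(i | P i) x i ^ (- e i) = 1.
Proof.
move=> nx; rewrite -big_split /= big1 // => i _; rewrite -expfzDr // subrr.
exact: expr0z.
Qed.

(** * Algebraically independent families *)

Section Independence.
Variables (K : idomainType) (m : nat) (F : fieldType) (h : {rmorphism K -> F}).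
Implicit Types (x : 'I_m -> F) (P : {mpoly K[m]}) (C : 'I_m -> 'I_m -> int).

Definition indep x := forall P, mmap h x P = 0 -> P = 0.

Section Point.
Variables (E : fieldType) (g : {rmorphism K -> E}) (x : 'I_m -> F) (pt : 'I_m -> E).
Hypothesis ix : indep x.

Definition kspec : F -> E -> Prop := spec (mmap h x) (mmap g pt).

Lemma kspec_ker P : mmap h x P = 0 -> mmap g pt P = 0.
Proof. by move/ix ->; rewrite rmorph0. Qed.

Lemma kspec_var i : kspec (x i) (pt i).
Proof. by have := spec_base (mmap h x) (mmap g pt) 'X_i; rewrite /= !mmapX !mmap1U. Qed.

Lemma kspecC c : kspec (h c) (g c).
Proof. by have := spec_base (mmap h x) (mmap g pt) c%:MP; rewrite /= !mmapC. Qed.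

Lemma kspec_ring : ring_rel kspec. Proof. exact: spec_ring kspec_ker. Qed.

Lemma kspecV a c : c != 0 -> kspec a c -> kspec a^-1 c^-1.
Proof. exact: specV. Qed.

Lemma kspec_fun a c d : kspec a c -> kspec a d -> c = d.
Proof. exact: (spec_fun kspec_ker). Qed.

Lemma kspec_neq0 a c : kspec a c -> c != 0 -> a != 0.
Proof. exact: (spec_neq0 kspec_ker). Qed.

End Point.

(** Specialise all variables to 1, where positivity keeps every cluster variable nonzero. *)
Lemma indep_nonvanishing (E : fieldType) (g : {rmorphism K -> E}) x C w :
  (forall n, (n%:R == 0 :> E) = (n == 0%N)) -> indep x -> nonvanishing (x, C) w.
Proof.
move=> char0 ix; pose pt (i : 'I_m) : E := 1.
apply: (nonvanishing_rel (kspec_ring g pt ix) (@kspecV _ g x pt)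
  (@kspec_neq0 _ g x pt ix) (kspec_var g x pt)).
by apply: posrat_nonvanishing => // i; apply: posrat1.
Qed.

Lemma exch_mutx x C k : C k k = 0 -> exch (mutx x C k) C k = exch x C k.
Proof.
move=> Ckk; congr (_ + _); apply: eq_bigr => i _; rewrite {1}/mutx;
  by case: eqVneq => [->|//]; rewrite Ckk.
Qed.

(* The specialisation of [x] at the point [x' = mutx x C k] sends [x'] to [x]. *)
Lemma indep_mutx x C k : C k k = 0 -> (forall i, x i != 0) ->
  (forall i, mutx x C k i != 0) -> indep x -> indep (mutx x C k).
Proof.
move=> Ckk nx; set x' := mutx x C k => nx' ix P P0; apply: (ix).
have rW := kspec_ring h x' ix.
have nE : exch x C k != 0.
  by have := nx' k; rewrite /x' /mutx eqxx mulf_eq0 negb_or => /andP[].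
(* Applying the formula twice with the same [C] returns [x], because [x_k] does not occur in the
   exchange binomial. *)
have x'x i : mutx x' C k i = x i.
  rewrite {1}/mutx; case: (eqVneq i k) => [->|ik].
    by rewrite /x' exch_mutx // /mutx eqxx invfM invrK -mulrA mulVf // mulr1.
  by rewrite /x' /mutx (negbTE ik).
apply: (kspec_fun ix (a := 0) (g := h) (pt := x')); last exact: (rrel0 rW).
rewrite -{1}P0; apply: mmap_rel => // [c|i]; first exact: kspecC.
have := mutx_rel rW (@kspecV _ h x x') C (kspec_var h x x') (nx' k) i.
by rewrite x'x.
Qed.

(** The ring [K[x^{+-1}]], as polynomials over a common monomial denominator. *)
Definition klaurent x (a : F) := exists P n, a * (\prod_i x i) ^+ n = mmap h x P.

Section KLaurent.
Variables (x : 'I_m -> F) (nx : forall i, x i != 0).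

Let ev_prod : mmap h x (\prod_i 'X_i) = \prod_i x i.
Proof. by rewrite rmorph_prod /=; apply: eq_bigr => i _; rewrite mmapX mmap1U. Qed.

Lemma klaurentC c : klaurent x (h c).
Proof. by exists c%:MP, 0%N; rewrite mulr1 mmapC. Qed.

Lemma klaurent_var i : klaurent x (x i).
Proof. by exists 'X_i, 0%N; rewrite mulr1 mmapX mmap1U. Qed.

Lemma klaurent_inv i : klaurent x (x i)^-1.
Proof.
exists (\prod_(l | l != i) 'X_l), 1%N; rewrite expr1 (bigD1 i) //= mulKf //.
by rewrite rmorph_prod /=; apply: eq_bigr => l _; rewrite mmapX mmap1U.
Qed.

Lemma klaurentD a b : klaurent x a -> klaurent x b -> klaurent x (a + b).
Proof.
move=> [P [n eP]] [Q [n' eQ]].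
exists (P * (\prod_i 'X_i) ^+ n' + Q * (\prod_i 'X_i) ^+ n), (n + n')%N.
by rewrite rmorphD !rmorphM !rmorphXn /= ev_prod -eP -eQ exprD; ring.
Qed.

Lemma klaurentM a b : klaurent x a -> klaurent x b -> klaurent x (a * b).
Proof.
move=> [P [n eP]] [Q [n' eQ]]; exists (P * Q), (n + n')%N.
by rewrite rmorphM /= -eP -eQ exprD mulrACA.
Qed.

Lemma klaurent_evl e : klaurent x (evl x e).
Proof.
elim: e => [c|i|i|e IH e' IH'|e IH e' IH'] /=.
- by rewrite -(rmorph_int h); apply: klaurentC.
- exact: klaurent_var.
- exact: klaurent_inv.
- exact: klaurentD.
- exact: klaurentM.
Qed.

(** Clearing denominators makes [P * Q] a monomial, so [P] is a monomial up to a unit; dividing back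
    lowers all exponents by [n]. *)
Lemma klaurent_unit u v : indep x -> klaurent x u -> klaurent x v -> u * v = 1 ->
  exists (c : K) (e : 'I_m -> int), c \is a GRing.unit /\ u = h c * \prod_i x i ^ e i.
Proof.
move=> ix [P [n eP]] [Q [n' eQ]] uv.
have ePQ : P * Q = 'X_[[multinom (n + n')%N | i < m]].
  apply/eqP; rewrite -subr_eq0; apply/eqP; apply: ix.
  rewrite rmorphB rmorphM /= -eP -eQ mulrACA uv mul1r -exprD mmapX /mmap1 -prodrXl.
  by apply/eqP; rewrite subr_eq0; apply/eqP; apply: eq_bigr => i _; rewrite mnmE.
have [c [b [uc eb]]] := mpoly_factor_monomial ePQ.
exists c, (fun i => (b i)%:Z - n%:Z); split=> //.
have nX : (\prod_i x i) ^+ n != 0 by rewrite expf_neq0 //; apply/prodf_neq0.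
apply: (mulIf nX); rewrite eP eb mmapZ mmapX /mmap1 -mulrA -prodrXl -big_split /=.
congr (_ * _); apply: eq_bigr => i _; rewrite expfzB // divfK //.
by rewrite expf_neq0.
Qed.

End KLaurent.

(* [x_k = E / x_k'] with [E] the exchange binomial, so a positive power of [x_k] in a
   unit of [K[x'^{+-1}]] would make [E] divide a monomial. *)
Lemma neighbour_exponent x C k c (e : 'I_m -> int) u v i :
  (forall i, x i != 0) -> (forall i, mutx x C k i != 0) -> indep x -> C k k = 0 ->
  C i k != 0 -> u = h c * \prod_i x i ^ e i -> klaurent (mutx x C k) v -> u * v = 1 ->
  e k <= 0.
Proof.
move=> nx nx' ix Ckk Cik eu [R [N eR]] uv; rewrite leNgt; apply/negP => ek.
have ix' := indep_mutx Ckk nx nx' ix; set x' := mutx x C k in nx' eR ix'.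
pose a := [multinom pz (C l k) | l < m]; pose b := [multinom pz (- C l k) | l < m].
pose Ex : {mpoly K[m]} := 'X_[a] + 'X_[b].
have evX (d : 'X_{1..m}) : mmap h x' 'X_[d] = \prod_l x' l ^+ d l by rewrite mmapX.
have eEx : mmap h x' Ex = exch x C k.
  rewrite -exch_mutx // rmorphD /= !evX; congr (_ + _);
    by apply: eq_bigr => l _; rewrite mnmE.
have nE : exch x C k != 0.
  by have := nx' k; rewrite /x' /mutx eqxx mulf_eq0 negb_or => /andP[].
have exk : x k = exch x C k * (x' k)^-1.
  by rewrite /x' /mutx eqxx invfM invrK mulrCA mulfV // mulr1.
(* In terms of [x'], the power [x_k ^ e k] is a power of the exchange binomial times a power of
   [x'_k] with exponent [- e k]. *)
pose f l := if l == k then - e k else e l.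
have eu' : u = h c * (exch x C k ^ e k * \prod_l x' l ^ f l).
  rewrite eu (bigD1 k) //= [in RHS](bigD1 k) //= /f eqxx {1}exk.
  rewrite expfzMl -!mulrA exprz_inv; congr (_ * (_ * (_ * _))).
  by apply: eq_bigr => l lk; rewrite (negbTE lk) /x' /mutx (negbTE lk).
have [s es] : exists s : nat, e k = s.+1 by case: (e k) ek => [[|s]|s] // _; exists s.
(* [d1] and [d2] clear the negative exponents in [f] and the denominator of [v], so that [u * v = 1]
   becomes an identity of polynomials. *)
pose d1 := [multinom pz (f l) | l < m].
pose d2 := [multinom (N + pz (- f l))%N | l < m].
have eq2 : Ex * (Ex ^+ s * (c%:MP * 'X_[d1] * R)) = 'X_[d2].
  apply/eqP; rewrite -subr_eq0; apply/eqP; apply: ix'.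
  rewrite rmorphB !rmorphM rmorphXn /= mmapC !evX eEx -eR; apply/eqP; rewrite subr_eq0.
  have -> : \prod_l x' l ^+ d2 l = (\prod_l x' l) ^+ N * \prod_l x' l ^+ pz (- f l).
    by rewrite -prodrXl -big_split /=; apply: eq_bigr => l _; rewrite mnmE exprD.
  have -> : \prod_l x' l ^+ d1 l = \prod_l x' l ^ f l * \prod_l x' l ^+ pz (- f l).
    rewrite -big_split /=; apply: eq_bigr => l _; rewrite mnmE -{2}(pzB (f l)).
    by rewrite expfzB // divfK // expf_neq0.
  have -> : exch x C k * (exch x C k ^+ s * (h c * (\prod_l x' l ^ f l *
      \prod_l x' l ^+ pz (- f l)) * (v * (\prod_l x' l) ^+ N)))
    = (u * v) * ((\prod_l x' l) ^+ N * \prod_l x' l ^+ pz (- f l)).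
    by rewrite eu' es -[_ ^ s.+1%:Z]/(_ ^+ s.+1) exprS; ring.
  by rewrite uv mul1r.
have [c' [d [_ eEd]]] := mpoly_factor_monomial eq2.
(* As [C i k] is nonzero, [Ex] has two distinct terms, whereas a divisor of a monomial has only
   one. *)
have ab : a != b.
  apply: contraNneq Cik => /mnmP /(_ i); rewrite !mnmE.
  by case: (C i k) => [[|l]|l].
have ba : (b == a) = false by rewrite eq_sym (negbTE ab).
have /eqP := congr1 (mcoeff a) eEd; have /eqP := congr1 (mcoeff b) eEd.
rewrite !mcoeffZ !mcoeffD !mcoeffX !eqxx (negbTE ab) ba addr0 add0r.
case: (eqVneq d b) => [->|_]; first by rewrite ba mulr0 oner_eq0.
by rewrite mulr0 oner_eq0.
Qed.

(** A positive power of [x_i] would send [u] to 0 while [v] has a value, against [u * v = 1]. *)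
Lemma frozen_exponent (E : fieldType) (g : {rmorphism K -> E}) x i c (e : 'I_m -> int) u v :
  let pt l : E := if l == i then 0 else 1 in
  indep x -> u = h c * \prod_l x l ^ e l -> (exists d, kspec g x pt v d) -> u * v = 1 ->
  e i <= 0.
Proof.
move=> pt ix eu [d vd] uv; rewrite leNgt; apply/negP => ei.
have rW := kspec_ring g pt ix.
have W0 : kspec g x pt u 0.
  have -> : 0 = g c * (0 * \prod_(l | l != i) 1 ^ e l) :> E by rewrite mul0r mulr0.
  rewrite eu (bigD1 i) //=; apply: (rrelM rW); first exact: kspecC.
  apply: (rrelM rW).
    case: (e i) ei => [[|s]|s] // _; have <- : 0 ^+ s.+1 = 0 :> E by rewrite expr0n.
    by apply: (rrelX rW); have := kspec_var g x pt i; rewrite /pt eqxx.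
  apply: (rrel_prod rW) => l li; apply: (rrel_exprz _ rW (@kspecV _ g x pt)).
    exact: oner_neq0.
  by have := kspec_var g x pt l; rewrite /pt (negbTE li).
have := rrelM rW W0 vd; rewrite uv mul0r => /(kspec_fun ix (rrel1 rW)) /eqP.
by rewrite oner_eq0.
Qed.

End Independence.

(** * Cluster algebras *)

Section Cluster.
Variables (K : idomainType) (m n p : nat) (nm : (n <= m)%N).
Variables (x : 'I_m -> ratfun K m) (B : 'M[int]_(m, n)) (C : 'I_m -> 'I_m -> int).

Definition Kto_rmorphism : {rmorphism K -> ratfun K m} :=
  @tofrac {mpoly K[m]} \o @mpolyC m K.
Local Notation h := Kto_rmorphism.

Hypothesis charK : forall l, (l%:R == 0 :> K) = (l == 0%N).
Hypothesis ix : indep h x.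
Hypotheses (BC : extends_mx nm B C) (sC : skewz C).

Let E : fieldType := {fraction K}.
Let g : {rmorphism K -> E} := @tofrac K.

Let charE l : (l%:R == 0 :> E) = (l == 0%N).
Proof. by rewrite -(rmorph_nat g) tofrac_eq0. Qed.

Lemma cluster_nonvanishing w : nonvanishing (x, C) w.
Proof. exact: (indep_nonvanishing g C w charE ix). Qed.

Lemma cluster_varP y : cluster_var nm x B y -> exists (w : seq 'I_m) i,
  (forall l, l \in w -> (l < n)%N) /\ y = (muts (x, C) w).1 i.
Proof.
move=> [t [i [xt ->]]]; have [w [wn [<- _]]] := mut_equiv_word BC xt.
by exists w, (widen_ord nm i).
Qed.

Lemma cluster_alg_klaurent x' u :
  (forall i, x' i != 0) -> (forall i : 'I_m, (n <= i)%N -> x' i = x i) ->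
  (forall w i, exists e, (muts (x, C) w).1 i = evl x' e) ->
  cluster_alg p nm x B u -> klaurent h x' u.
Proof.
move=> nx' ex' Lw; elim=> [c|y gy|y z _ IHy _ IHz|y z _ IHy _ IHz].
- exact: (klaurentC h x' c).
- case: gy => [/cluster_varP [w [i [_ ->]]]|[i [ni _ yi]]|[i [pi ->]]].
  + by have [e ->] := Lw w i; apply: klaurent_evl.
  + case: yi => ->; rewrite -ex' //; [exact: klaurent_var|exact: klaurent_inv].
  + case: (ltnP i n) => [ni|ni]; last by rewrite -ex' //; apply: klaurent_var.
    by have [e] := Lw [::] i; rewrite /= => ->; apply: klaurent_evl.
- exact: klaurentD.
- exact: klaurentM.
Qed.

Lemma cluster_alg_klaurent_initial u : cluster_alg p nm x B u -> klaurent h x u.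
Proof.
have nx i : x i != 0 by apply: nonvanishing0 i (cluster_nonvanishing [::]).
apply: cluster_alg_klaurent => // w i.
have [e He] := laurent_phenomenon w sC i; exists e; apply: He.
exact: cluster_nonvanishing.
Qed.

(** From [mu_k x] the word [k :: w] first returns to [x] and then follows [w], so the Laurent
    phenomenon applies to the cluster [mu_k x] too. *)
Lemma cluster_alg_klaurent_neighbour (k : 'I_m) u : (k < n)%N ->
  cluster_alg p nm x B u -> klaurent h (mutx x C k) u.
Proof.
move=> kn; pose s := mut (x, C) k.
have nv w : nonvanishing s w by have [_] := cluster_nonvanishing (k :: w).
have eK : mut s k = (x, C).
  by apply: mutK_nonvanishing (cluster_nonvanishing [:: k]); apply: skewz_diag.
have nvk w : nonvanishing s (k :: w).
  split=> [i|]; first exact: nonvanishing0 i (nv [::]).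
  by rewrite eK; apply: cluster_nonvanishing.
apply: cluster_alg_klaurent => [i|i ni|w i].
- exact: nonvanishing0 i (nv [::]).
- by rewrite /mutx; case: eqP => // ik; rewrite ik leqNgt kn in ni.
- have [e He] := laurent_phenomenon (k :: w) (skewz_mutb k sC) i; exists e.
  by rewrite -(He _ s.1 (nvk w)) -[muts _ (k :: w)]/(muts (mut s k) w) eK.
Qed.

Lemma cluster_alg_kspec (i : 'I_m) u : (n <= p)%N -> (p <= i)%N ->
  cluster_alg p nm x B u ->
  exists d, kspec h g x (fun l => if l == i then 0 else 1) u d.
Proof.
move=> np pi; pose pt l : E := if l == i then 0 else 1.
suff : cluster_alg p nm x B u -> exists d, kspec h g x pt u d by [].
have rW := kspec_ring g pt ix.
elim=> [c|y gy|y z _ [a ya] _ [b zb]|y z _ [a ya] _ [b zb]].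
- by exists (g c); apply: kspecC.
- case: gy => [/cluster_varP [w [l [wn ->]]]|[l [nl lp yl]]|[l [_ ->]]].
  + exists ((muts (pt, C) w).1 l); apply: muts_rel => //; first exact: kspecV.
      exact: kspec_var.
    (* The letters of [w] are below [n <= p <= i], so no mutation inverts [x_i]. *)
    apply: (@posrat_but_mutable E charE _ (Some i)) => [k /wn kn|k].
      apply: contraTneq kn => -[->]; by rewrite -leqNgt (leq_trans np).
    by rewrite /pt; case: (eqVneq k i) => [->|ki];
      rewrite ?eqxx // (inj_eq (@Some_inj _)) (negbTE ki); apply: posrat1.
  (* Inverted frozen variables have an index below [p <= i], hence the value 1. *)
  + have li : l != i by apply: contraTneq lp => ->; rewrite -leqNgt.
    have W1 : kspec h g x pt (x l) 1.
      by have := kspec_var h g x pt l; rewrite {2}/pt (negbTE li).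
    exists 1; case: yl => -> //; rewrite -[1 in X in kspec _ _ _ _ _ X]invr1.
    by apply: kspecV => //; apply: oner_neq0.
  + by exists (pt l); apply: kspec_var.
- by exists (a + b); apply: (rrelD rW).
- by exists (a * b); apply: (rrelM rW).
Qed.

End Cluster.

Lemma in_subalg_exprz (K : idomainType) (m : nat) (S : ratfun K m -> Prop) y (a : int) :
  in_subalg S y -> in_subalg S y^-1 -> in_subalg S (y ^ a).
Proof.
have sX z l : in_subalg S z -> in_subalg S (z ^+ l).
  move=> Sz; elim: l => [|l IH]; last by rewrite exprS; apply: sa_mul.
  by rewrite expr0 -[1]/(Kto m (1 : K)); apply: sa_const.
move=> Sy SV; case: a => a; first exact: sX.
by rewrite -[y ^ _]exprVn; apply: sX.
Qed.

(** As [m > 1], a path leads from [k] to another vertex. Its first edge is a nonzero entry in row or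
    column [k], and skew-symmetry of signs moves it to the column. *)
Lemma connected_column (m n : nat) (nm : (n <= m)%N) (B : 'M[int]_(m, n)) C (k : 'I_m) :
  (1 < m)%N -> connected_mx B -> extends_mx nm B C -> skewz C -> (k < n)%N ->
  exists i, C i k != 0.
Proof.
move=> m1 cB BC sC kn.
have [l lk] : exists l : 'I_m, l != k.
  pose l0 := Ordinal (ltnW m1); pose l1 := Ordinal m1.
  by case: (eqVneq k l0) => [->|]; [exists l1|exists l0; rewrite eq_sym].
have /connectP [[|j w] /= kw el] := cB k l; first by rewrite el eqxx in lk.
case/andP: kw => /orP[] + _ {el}.
  case: insubP => // j' _ _; rewrite -BC; set l' := widen_ord nm j' => Ckl.
  exists l'; apply: contraNneq Ckl => C0.
  have := skewz_gt0 k l' sC; have := skewz_gt0 l' k sC; rewrite C0 ltxx.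
  by case: ltrgt0P.
case: insubP => // k' _ ek; have -> : k = widen_ord nm k' by apply: val_inj.
by rewrite -BC => Cjk; exists j.
Qed.

Theorem theorem2p2 (K : idomainType)
  (HK : ((forall c : K, c != 0 -> c \is a GRing.unit) /\ [pchar K] =i pred0)
        \/ bijective (fun z : int => z%:~R : K))
  (m n p : nat) (Hn : (1 <= n)%N) (Hnp : (n <= p)%N) (Hpm : (p <= m)%N)
  (Hm : (1 < m)%N)
  (x : 'I_m -> ratfun K m) (B : 'M[int]_(m, n))
  (Hseed : is_seed (leq_trans Hnp Hpm) x B) :
  forall u : ratfun K m,
    unit_of (cluster_alg p (leq_trans Hnp Hpm) x B) u <->
    exists (lam : K) (a : 'I_m -> int),
      lam \is a GRing.unit /\
      u = Kto m lam * \prod_(i < m | (n <= i < p)%N) x i ^ a i.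
Proof.
have [ax cB sB] := Hseed; set nm := leq_trans Hnp Hpm in sB *.
(* [K] has characteristic 0 in both cases; in the second one this is the injectivity of the
   canonical map from the integers. *)
have charK l : (l%:R == 0 :> K) = (l == 0%N).
  case: HK => [[_ /pcharf0P ->]|/bij_inj zK] //.
  by apply/eqP/eqP => [l0|->//]; have /(_ 0 l0) [] := zK l%:Z.
have [C BC sC] := square_extension sB.
pose h := Kto_rmorphism K m; have ix : indep h x := ax.
have nv := cluster_nonvanishing C charK ix.
have nx i : x i != 0 by apply: nonvanishing0 i (nv [::]).
move=> u; split=> [[Au [v [Av uv]]]|[c [a [uc ->]]]].
- have vu : v * u = 1 by rewrite mulrC.
  have Ku := cluster_alg_klaurent_initial charK ix BC sC Au.
  have Kv := cluster_alg_klaurent_initial charK ix BC sC Av.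
  have [c [e [uc eu]]] := klaurent_unit nx ix Ku Kv uv.
  (* [v] has the opposite exponents, so an upper bound on exponents, applied to [u] and to [v],
     gives equality. *)
  have ev : v = h c^-1 * \prod_i x i ^ (- e i).
    have nu : u != 0 by apply: contra_eq_neq uv => ->; rewrite mul0r eq_sym oner_neq0.
    apply: (mulfI nu); rewrite uv eu mulrACA -rmorphM divrr // rmorph1 mul1r.
    by rewrite (prod_exprzN _ _ nx).
  have e0 (i : 'I_m) : ~~ (n <= i < p)%N -> e i = 0.
    move=> ni; apply/eqP; rewrite eq_le -oppr_le0.
    case: (ltnP i n) ni => [ki _|ni] /=.
      have [l Cl] := connected_column Hm cB BC sC ki.
      have Ci := skewz_diag i sC.
      have nx' l' : mutx x C i l' != 0 by apply: nonvanishing_muts l' (nv [:: i]).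
      apply/andP; split.
        apply: (neighbour_exponent nx nx' ix Ci Cl eu _ uv).
        exact: (cluster_alg_klaurent_neighbour charK ix BC sC ki Av).
      apply: (neighbour_exponent nx nx' ix Ci Cl ev _ vu).
      exact: (cluster_alg_klaurent_neighbour charK ix BC sC ki Au).
    rewrite -leqNgt => pi; apply/andP; split.
      apply: (frozen_exponent ix eu _ uv).
      exact: (cluster_alg_kspec charK ix BC Hnp pi Av).
    apply: (frozen_exponent ix ev _ vu).
    exact: (cluster_alg_kspec charK ix BC Hnp pi Au).
  exists c, e; split=> //; rewrite eu; congr (_ * _).
  rewrite [RHS]big_mkcond /=; apply: eq_bigr => i _; case: ifPn => // /e0 ->.
  exact: expr0z.
(* The inverse of such a monomial has the same form, so it suffices that all of them lie in the
   algebra. *)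
- have Aa (b : 'I_m -> int) c' : cluster_alg p nm x B
      (Kto m c' * \prod_(i < m | (n <= i < p)%N) x i ^ b i).
    apply: sa_mul; first exact: sa_const.
    apply: (big_ind (cluster_alg p nm x B)) => [||i /andP[ni ip]].
    + by rewrite -[1]/(Kto m (1 : K)); apply: sa_const.
    + exact: sa_mul.
    + apply: in_subalg_exprz; apply: sa_gen; apply: Or32; exists i; split=> //.
        by left.
      by right.
  split; first exact: Aa.
  exists (Kto m c^-1 * \prod_(i < m | (n <= i < p)%N) x i ^ (- a i)).
  split; first exact: Aa.
  rewrite mulrACA -[Kto m c]/(h c) -[Kto m c^-1]/(h c^-1) -rmorphM divrr //.
  by rewrite rmorph1 mul1r (prod_exprzN _ _ nx).
Qed.
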